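(* For $n\in\mathbb{N}_0$ and $x>0$ let $\tilde{\omega}_n(x):=\frac{(-x)^n K_0^{(n)}(x)}{n!}$, and let $\tilde\omega_n^{(m)}$ denote its $m$-th derivative. The following hold. 1. (General estimate.) There exists a constant $\gamma\ge 1$, independent of $m,n,x$, such that for all $n,m\in\mathbb{N}_0$ and all $x>0$ $$\left|\tilde{\omega}_n^{(m)}(x)\right|\le m!\left(\frac{\gamma\sqrt{n+1}}{x}\right)^m\left(\frac{\delta_{m,0}}{\sqrt{2x+1}}+\frac{\gamma}{\sqrt{n+1}}\left(1+\delta_{m+n,0}\log\frac{x+1}{x}\right)\right).$$ 2. (Refined estimates for small and large arguments.) (a) (Small argument.) For every given $C>1$ (independent of $m,n,x$) there exists a constant $\gamma>1$, independent of $m,n,x$, such that for all integers $n\ge 0$ and all integers $m$ with $0\le m\le \sqrt{n}\left(\frac{C-1}{C}\right)$ satisfying the further restriction $$2\left\lfloor \frac{m\log(n+1)}{4\log 2}\right\rfloor-2\le\frac{n-1}{2},$$ and for all $x$ with $$0<x\le\min\left\{\frac{n}{2C},\frac{n+1}{4\gamma}\right\},$$ it holds $$\left|\tilde{\omega}_n^{(m)}(x)\right|\le m!\left(\frac{\gamma}{x}\right)^m\left(\frac{\delta_{m,0}}{\sqrt{2x+1}}+\frac{\gamma}{\sqrt{n+1}}\left(1+\delta_{n+m,0}\log\frac{x+1}{x}\right)\right).$$ (b) (Large argument.) There exists a constant $\gamma\ge1$, independent of $m,n,x$, such that for all integers $n\ge 0$ and all integers $m\ge 1+2\log(n+1)$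 it holds $$\left|\tilde{\omega}_n^{(m)}(x)\right|\le m!\left(\frac{\gamma}{x}\right)^m\qquad\text{for all } x>\begin{cases}0 & \text{if } n=0,1,\\ n+m(\sqrt{n}+2) & \text{if } n\ge2.\end{cases}$$ 3. (Exponential decay.) For all $n\in\mathbb{N}_0$ and all $x\ge\max\{1,n+\sqrt{n}\}$, $$\left|\tilde{\omega}_n(x)\right|\le 3\,\frac{\exp\left(\sqrt{n}-\frac{x}{1+\sqrt{n}}\right)}{\sqrt{n+1}}.$$
   Context: $K_0$ is the modified Bessel function of the second kind of order zero, and $K_0^{(n)}$ is its $n$-th derivative on $(0,\infty)$; for $x>0$, $K_0(x)=\int_1^\infty \frac{e^{-xt}}{\sqrt{t^2-1}}\,dt$. $\mathbb{N}_0=\{0,1,2,\dots\}$, $\log$ is the natural logarithm, $\lfloor\cdot\rfloor$ is the floor function, and $\delta_{i,j}$ is the Kronecker delta. The constants $\gamma$ in the different parts need not coincide. *)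

(* Defs.v *)
From Stdlib Require Import Reals Factorial.
From Coquelicot Require Import Coquelicot.
Open Scope R_scope.

(* Improper Riemann integral over (1, +oo), singular at both ends. It converges
   exactly for x > 0; for x <= 0 the value of [RInt_gen] carries no meaning. *)
Definition K0 (x : R) : R :=
  RInt_gen (V := R_CompleteNormedModule)
    (fun t => exp (- x * t) / sqrt (t ^ 2 - 1))
    (at_right 1) (Rbar_locally p_infty).

(* K0 is smooth on (0, +oo) and derivatives are local, so for x > 0 the total
   operator [Derive_n] gives the genuine derivatives of K0 and of [omega n]. *)
Definition omega (n : nat) (x : R) : R :=
  (- x) ^ n * Derive_n K0 n x / INR (fact n).

Definition kronecker (i j : nat) : R := if Nat.eqb i j then 1 else 0.

Definition floor_R (r : R) : R := IZR (Int_part r).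

(* Main.v *)
Require Import Defs.
From Stdlib Require Import Reals Factorial ZArith Lra Lia.
From Coquelicot Require Import Coquelicot.
Open Scope R_scope.

(** With [g n s = s ^ n * exp (- s) / n!] one has
    [omega n x = int_1^oo g n (x * t) / sqrt (t ^ 2 - 1) dt], and
    [/ sqrt (t ^ 2 - 1) <= / (t ^ 2 * sqrt (t ^ 2 - 1)) + / t], whose first term has the
    bounded primitive [sqrt (t ^ 2 - 1) / t]; this bounds [omega n] itself.

    The Taylor coefficient [s ^ m / m! * D^m (g n) s] is [g n s] times a Laguerre
    polynomial. A differential inequality for the generating function of the absolute
    values of these polynomials replaces Cauchy's estimate on a circle of relative radius
    [r = 1 / (4 * sqrt (n + 1))]: it bounds the coefficient by
    [2 * r ^ - m * (g n ((1 - b) * s) + g n ((1 + b) * s))] with [b = 3 * r / 2].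
    Integrating gives the general estimate. For large [x] it combines with the tail bound
    on [omega n] that comes from the tangent line of [ln (g n)].

    For small [x], Bessel's equation gives
    [omega (n + 2) ' = x * (x * omega n) ' / ((n + 2) * (n + 1))]; each use of it gains a
    factor [1 / 4] in the Taylor coefficients, and about [m * log_16 (n + 1)] uses absorb
    the factor [sqrt (n + 1) ^ m] of the general estimate. *)

(** The radius is dictated by the shape of [poisson n]: its bump has relative width of order
    [/ sqrt (n + 1)], and tilting by [b] costs [exp (2 * n * b ^ 2)], which stays bounded only for
    [b] of at most that order. Hence the loss [sqrt (n + 1) ^ m], which the two refined estimates
    must win back. For large [x] the shrunken argument still lies about [m] widths to the right of
    the bump, and the Gaussian decay there pays for [(n + 1) ^ (m / 2)] once [m] exceeds a multiple
    of [ln (n + 1)]. For small [x] each gain of [/ 4] lowers the index by two, and the floor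
    condition ensures that an index of at least [(n + 1) / 2] remains, still large compared with
    [x]. The logarithm belongs to [n = m = 0] alone, so [n = 0 < m] has to avoid any return to
    [omega 0]. *)

(** * Improper integrals over (1, oo) through primitives *)

Lemma is_derive_increment (F f : R -> R) (a b : R) :
  a < b -> (forall t, a <= t <= b -> is_derive F t (f t)) ->
  exists c, a <= c <= b /\ F b - F a = f c * (b - a).
Proof.
  intros Hab HF.
  destruct (MVT_gen F a b f) as [c [Hc Hd]].
  - rewrite Rmin_left, Rmax_right by lra. intros; apply HF; lra.
  - rewrite Rmin_left, Rmax_right by lra. intros t Ht.
    apply continuity_pt_filterlim, @ex_derive_continuous.
    exists (f t); apply HF; lra.
  - rewrite Rmin_left, Rmax_right in Hc by lra. exists c; split; auto.
Qed.

Lemma derive_le_increment (F f G g : R -> R) (a b : R) :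
  a <= b -> (forall t, a <= t <= b -> is_derive F t (f t)) ->
  (forall t, a <= t <= b -> is_derive G t (g t)) ->
  (forall t, a <= t <= b -> f t <= g t) -> F b - F a <= G b - G a.
Proof.
  intros Hab HF HG Hfg.
  destruct (Req_dec a b) as [->|Hne]; [lra|].
  destruct (is_derive_increment (fun t => G t - F t) (fun t => g t - f t) a b)
    as [c [Hc Hd]]; [lra| |].
  - intros t Ht. apply (is_derive_minus G F t (g t) (f t)); auto.
  - specialize (Hfg c Hc). assert (0 <= (g c - f c) * (b - a)) by nra. lra.
Qed.

(** The improper integral over (1, oo), encoded by a primitive that tends to 0 at 1 and to [l] at
    infinity. Linearity, comparison and integration by parts become statements about derivatives. *)
Definition newton_int (f : R -> R) (l : R) : Prop :=
  exists F : R -> R,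
    (forall t, 1 < t -> is_derive F t (f t)) /\
    (forall e, 0 < e -> exists d, 0 < d /\ forall t, 1 < t < 1 + d -> Rabs (F t) < e) /\
    (forall e, 0 < e -> exists M, forall t, M < t -> Rabs (F t - l) < e).

Lemma newton_int_is_RInt_gen (f : R -> R) (l : R) :
  (forall t, 1 < t -> continuous f t) -> newton_int f l ->
  is_RInt_gen (V := R_NormedModule) f (at_right 1) (Rbar_locally p_infty) l.
Proof.
  intros Hc [F [HF [H1 H2]]].
  assert (Hpos : filter_prod (at_right 1) (Rbar_locally p_infty)
    (fun ab => forall x, Rmin (fst ab) (snd ab) <= x <= Rmax (fst ab) (snd ab) -> 1 < x)).
  { apply Filter_prod with (fun a => 1 < a) (fun b => 1 < b).
    - exists (mkposreal 1 Rlt_0_1); auto.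
    - exists 1; auto.
    - intros a b Ha Hb x [Hx _]; simpl in *.
      apply Rlt_le_trans with (2 := Hx). apply Rmin_glb_lt; auto. }
  assert (HD : forall x, 1 < x -> Derive F x = f x)
    by (intros; apply is_derive_unique; auto).
  apply is_RInt_gen_ext with (Derive F).
  { revert Hpos; apply filter_imp; intros ab H x Hx; apply HD, H; lra. }
  replace l with (l - 0) by ring.
  apply is_RInt_gen_Derive.
  - revert Hpos; apply filter_imp; intros ab H x Hx. exists (f x); auto.
  - revert Hpos; apply filter_imp; intros ab H x Hx. specialize (H x Hx).
    apply continuous_ext_loc with f; [|auto].
    apply (locally_interval _ x 1 p_infty); simpl; auto.
    intros; symmetry; auto.
  - apply filterlim_locally; intros [e He].
    destruct (H1 e He) as [d [Hd Ht]]. exists (mkposreal d Hd).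
    intros t Hb Ht1. apply Rabs_def2 in Hb. unfold ball; simpl; unfold AbsRing_ball, abs, minus, plus, opp; simpl.
    replace (F t + - 0) with (F t) by ring. apply Ht.
    unfold minus, plus, opp in Hb; simpl in Hb. lra.
  - apply filterlim_locally; intros [e He].
    destruct (H2 e He) as [M HM]. exists M. intros t Ht. apply (HM t Ht).
Qed.

Lemma newton_int_RInt_gen (f : R -> R) (l : R) :
  (forall t, 1 < t -> continuous f t) -> newton_int f l ->
  RInt_gen (V := R_CompleteNormedModule) f (at_right 1) (Rbar_locally p_infty) = l.
Proof.
  intros Hc Hl.
  exact (@is_RInt_gen_unique R_CompleteNormedModule (at_right 1) (Rbar_locally p_infty)
    (Proper_StrongProper _ (at_right_proper_filter 1))
    (Proper_StrongProper _ (Rbar_locally_filter p_infty))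
    f l (newton_int_is_RInt_gen f l Hc Hl)).
Qed.

Lemma newton_int_ext (f g : R -> R) (l : R) :
  (forall t, 1 < t -> f t = g t) -> newton_int f l -> newton_int g l.
Proof.
  intros Hfg [F [HF H]]. exists F; split; auto.
  intros t Ht; rewrite <- Hfg; auto.
Qed.

Lemma newton_int_lincomb (a b : R) (f g : R -> R) (lf lg : R) :
  newton_int f lf -> newton_int g lg ->
  newton_int (fun t => a * f t + b * g t) (a * lf + b * lg).
Proof.
  intros [F [HF [F1 F2]]] [G [HG [G1 G2]]].
  exists (fun t => a * F t + b * G t).
  set (K := Rabs a + Rabs b + 1).
  assert (HK : 0 < K) by (unfold K; pose proof (Rabs_pos a); pose proof (Rabs_pos b); lra).
  assert (Hsm : forall u v e, 0 < e -> Rabs u < e / K -> Rabs v < e / K ->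
      Rabs (a * u + b * v) < e).
  { intros u v e He Hu Hv. apply Rle_lt_trans with (1 := Rabs_triang _ _).
    rewrite !Rabs_mult. set (d := e / K) in *.
    replace e with (K * d) by (unfold d; field; lra). unfold K.
    assert (0 < d) by (apply Rdiv_lt_0_compat; auto).
    pose proof (Rabs_pos a); pose proof (Rabs_pos b).
    nra. }
  split; [|split].
  - intros t Ht. apply (is_derive_plus (fun t => a * F t) (fun t => b * G t) t (a * f t) (b * g t));
      apply (is_derive_scal _ t); auto.
  - intros e He. assert (He' : 0 < e / K) by (apply Rdiv_lt_0_compat; auto).
    destruct (F1 _ He') as [d1 [Hd1 H1]], (G1 _ He') as [d2 [Hd2 H2]].
    exists (Rmin d1 d2); split; [apply Rmin_glb_lt; auto|].
    intros t Ht. pose proof (Rmin_l d1 d2); pose proof (Rmin_r d1 d2).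
    apply Hsm; auto; [apply H1|apply H2]; lra.
  - intros e He. assert (He' : 0 < e / K) by (apply Rdiv_lt_0_compat; auto).
    destruct (F2 _ He') as [d1 H1], (G2 _ He') as [d2 H2].
    exists (Rmax d1 d2).
    intros t Ht. pose proof (Rmax_l d1 d2); pose proof (Rmax_r d1 d2).
    replace (a * F t + b * G t - (a * lf + b * lg))
      with (a * (F t - lf) + b * (G t - lg)) by ring.
    apply Hsm; auto; [apply H1|apply H2]; lra.
Qed.

(** A bounded primitive of the majorant suffices, without limits at the ends:
    [F b - F a <= G b - G a <= B - A], while [F a] is near 0 and [F b] is near [l]. *)
Lemma newton_int_le_primitive (f g G : R -> R) (l A B : R) :
  newton_int f l -> (forall t, 1 < t -> is_derive G t (g t)) ->
  (forall t, 1 < t -> A <= G t <= B) -> (forall t, 1 < t -> f t <= g t) ->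
  l <= B - A.
Proof.
  intros [F [HF [F1 F2]]] HG HAB Hfg.
  apply Rle_plus_epsilon. intros e He.
  assert (He' : 0 < e / 2) by lra.
  destruct (F1 _ He') as [d [Hd H1]], (F2 _ He') as [M HM].
  set (b := Rmax M (1 + d) + 1).
  assert (Hb1 : M < b) by (unfold b; pose proof (Rmax_l M (1 + d)); lra).
  assert (Hb2 : 1 + d < b) by (unfold b; pose proof (Rmax_r M (1 + d)); lra).
  specialize (HM b Hb1). assert (Ha := H1 (1 + d / 2) ltac:(lra)).
  apply Rabs_def2 in HM. apply Rabs_def2 in Ha.
  assert (F b - F (1 + d / 2) <= G b - G (1 + d / 2)).
  { apply derive_le_increment with f g; [lra| | |]; intros; [apply HF|apply HG|apply Hfg]; lra. }
  pose proof (HAB b ltac:(lra)). pose proof (HAB (1 + d / 2) ltac:(lra)). lra.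
Qed.

Lemma newton_int_le (f g : R -> R) (lf lg : R) :
  newton_int f lf -> newton_int g lg -> (forall t, 1 < t -> f t <= g t) -> lf <= lg.
Proof.
  intros Hf Hg Hfg.
  assert (1 * lf + (-1) * lg <= 0 - 0); [|lra].
  apply newton_int_le_primitive with (fun t => 1 * f t + (-1) * g t) (fun _ => 0) (fun _ => 0).
  - apply newton_int_lincomb; auto.
  - intros; apply @is_derive_const.
  - intros; lra.
  - intros t Ht; specialize (Hfg t Ht); lra.
Qed.

Lemma newton_int_unique (f : R -> R) (l l' : R) :
  newton_int f l -> newton_int f l' -> l = l'.
Proof.
  intros H H'. apply Rle_antisym; eapply newton_int_le; eauto; intros; lra.
Qed.

Lemma newton_int_exists (f g G : R -> R) (A B : R) :
  (forall t, 1 < t -> continuous f t) -> (forall t, 1 < t -> 0 <= f t <= g t) ->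
  (forall t, 1 < t -> is_derive G t (g t)) -> (forall t, 1 < t -> A <= G t <= B) ->
  exists l, newton_int f l.
Proof.
  intros Hc Hfg HG HAB.
  set (F := (fun t => RInt (V := R_CompleteNormedModule) f 2 t) : R -> R).
  assert (HF : forall t, 1 < t -> is_derive F t (f t)).
  { intros t Ht. apply is_derive_RInt with 2; auto.
    apply (locally_interval _ t 1 p_infty); simpl; auto.
    intros y Hy _. apply (RInt_correct (V := R_CompleteNormedModule) f 2 y), @ex_RInt_continuous.
    intros z [Hz _]. apply Hc. apply Rlt_le_trans with (2 := Hz).
    apply Rmin_glb_lt; lra. }
  assert (Hmono : forall a b, 1 < a <= b -> 0 <= F b - F a <= B - A).
  { intros a b Hab. split.
    - enough (0 - 0 <= F b - F a) by lra.
      apply (derive_le_increment (fun _ => 0) (fun _ => 0) F f a b); try lra.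
      + intros; apply @is_derive_const.
      + intros; apply HF; lra.
      + intros; apply Hfg; lra.
    - pose proof (HAB a ltac:(lra)). pose proof (HAB b ltac:(lra)).
      assert (F b - F a <= G b - G a); [|lra].
      apply derive_le_increment with f g; try lra; intros.
      + apply HF; lra.
      + apply HG; lra.
      + apply Hfg; lra. }
  (* [F] is nondecreasing with increments at most [B - A], so it has limits at both ends: [U] at
     infinity and, with the [L] obtained next, [- L] at 1. Adding [L] moves the limit at 1 to
     zero. *)
  destruct (completeness (fun y => exists t, 1 < t /\ y = F t)) as [U [HU1 HU2]].
  { exists (F 2 + (B - A)). intros y [t [Ht ->]].
    destruct (Rle_dec t 2); [pose proof (Hmono t 2); pose proof (Hmono 2 2)|pose proof (Hmono 2 t)]; lra. }
  { exists (F 2), 2; split; lra. }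
  destruct (completeness (fun y => exists t, 1 < t /\ y = - F t)) as [L [HL1 HL2]].
  { exists (- F 2 + (B - A)). intros y [t [Ht ->]].
    destruct (Rle_dec t 2); [pose proof (Hmono t 2)|pose proof (Hmono 2 t); pose proof (Hmono 2 2)]; lra. }
  { exists (- F 2), 2; split; lra. }
  exists (U + L), (fun t => F t + L). split; [|split].
  - intros t Ht. replace (f t) with (f t + 0) by ring.
    apply (is_derive_plus F (fun _ => L) t (f t) 0); [auto|apply @is_derive_const].
  - intros e He.
    assert (exists t, 1 < t /\ L - e < - F t) as [t [Ht HtL]].
    { apply Classical_Prop.NNPP. intros Hn. assert (L <= L - e); [|lra].
      apply HL2. intros y [t [Ht ->]]. apply Rnot_lt_le. intros Hl. apply Hn. exists t; auto. }
    exists (t - 1). split; [lra|]. intros s Hs.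
    pose proof (Hmono s t ltac:(lra)).
    assert (- F s <= L) by (apply HL1; exists s; split; lra).
    apply Rabs_def1; lra.
  - intros e He.
    assert (exists t, 1 < t /\ U - e < F t) as [t [Ht HtL]].
    { apply Classical_Prop.NNPP. intros Hn. assert (U <= U - e); [|lra].
      apply HU2. intros y [t [Ht ->]]. apply Rnot_lt_le. intros Hl. apply Hn. exists t; auto. }
    exists t. intros s Hs.
    pose proof (Hmono t s ltac:(lra)).
    assert (F s <= U) by (apply HU1; exists s; split; lra).
    apply Rabs_def1; lra.
Qed.

(** * Elementary inequalities and the Poisson density *)

(** With [w = exp u] this is [u <= sinh u]. The error is of third order at [w = 1], the accuracy
    that [poisson_mode] and [poisson_upper_tail] rely on. *)
Lemma ln_le_half_diff (w : R) : 1 <= w -> ln w <= (w - / w) / 2.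
Proof.
  intros Hw.
  assert (H : ln w - ln 1 <= (w - / w) / 2 - (1 - / 1) / 2).
  { apply (derive_le_increment ln (fun t => / t) (fun t => (t - / t) / 2)
      (fun t => (1 + / t ^ 2) / 2)); auto.
    - intros t Ht. apply is_derive_Reals, derivable_pt_lim_ln; lra.
    - intros t Ht. auto_derive; [lra|field; lra].
    - intros t Ht. assert (0 <= (1 - / t) ^ 2) by apply pow2_ge_0.
      replace (/ t ^ 2) with (/ t * / t) by (field; lra). nra. }
  rewrite ln_1, Rinv_1 in H. lra.
Qed.

Lemma exp_mult_INR (n : nat) (y : R) : exp (INR n * y) = exp y ^ n.
Proof.
  induction n as [|n IH]; [simpl; rewrite Rmult_0_l; apply exp_0|].
  rewrite S_INR, Rmult_plus_distr_r, exp_plus, IH, Rmult_1_l. simpl; ring.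
Qed.

Lemma exp_le_compat (a b : R) : a <= b -> exp a <= exp b.
Proof. intros [H| ->]; [left; apply exp_increasing; auto|lra]. Qed.

(** Bounding the exponential below by its tangent at 0 turns [(1 + b) * exp (- b + b ^ 2 * 2)] into
    [1 + b ^ 2 * (1 + 2 * b)], which explains the range of [b]. *)
Lemma Rinv_le_exp (b : R) : -1/2 <= b -> / (1 + b) <= exp (- b + b ^ 2 * 2).
Proof.
  intros Hb.
  assert (1 <= (1 + b) * exp (- b + b ^ 2 * 2)).
  { assert (1 + (- b + b ^ 2 * 2) <= exp (- b + b ^ 2 * 2)) by apply exp_ineq1_le.
    apply Rle_trans with ((1 + b) * (1 + (- b + b ^ 2 * 2))); [|apply Rmult_le_compat_l; lra].
    assert (0 <= b ^ 2 * (1 + 2 * b)) by (apply Rmult_le_pos; [apply pow2_ge_0|lra]).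
    nra. }
  apply Rmult_le_reg_l with (1 + b); [lra|].
  rewrite Rinv_r; lra.
Qed.

(* The Poisson density, so that [omega n x] is the integral over [t > 1] of
   [poisson n (x * t) / sqrt (t ^ 2 - 1)]. *)
Definition poisson (n : nat) (s : R) : R := s ^ n * exp (- s) / INR (fact n).

Lemma poisson_pos (n : nat) (s : R) : 0 <= s -> 0 <= poisson n s.
Proof.
  intros Hs. unfold poisson.
  apply Rmult_le_pos; [apply Rmult_le_pos; [apply pow_le; auto|left; apply exp_pos]|].
  left; apply Rinv_0_lt_compat, INR_fact_lt_0.
Qed.

(** [n * ln s - s] is concave with slope [n / s0 - 1] at [s0]. Without logarithms this is
    [s <= s0 * exp (s / s0 - 1)] raised to the power [n], which also covers [s = 0]. *)
Lemma poisson_tangent (n : nat) (s s0 : R) : 0 <= s -> 0 < s0 ->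
  poisson n s <= poisson n s0 * exp (- ((1 - INR n / s0) * (s - s0))).
Proof.
  intros Hs Hs0. unfold poisson.
  replace (- ((1 - INR n / s0) * (s - s0))) with (INR n * (s / s0 - 1) + (- s + s0))
    by (field; lra).
  rewrite !exp_plus, exp_mult_INR.
  replace (s0 ^ n * exp (- s0) / INR (fact n) * (exp (s / s0 - 1) ^ n * (exp (- s) * exp s0)))
    with ((s0 * exp (s / s0 - 1)) ^ n * exp (- s) / INR (fact n) * (exp (- s0) * exp s0))
    by (rewrite Rpow_mult_distr; field; apply INR_fact_neq_0).
  rewrite <- (exp_plus (- s0)), Rplus_opp_l, exp_0, Rmult_1_r.
  unfold Rdiv. apply Rmult_le_compat_r; [left; apply Rinv_0_lt_compat, INR_fact_lt_0|].
  apply Rmult_le_compat_r; [left; apply exp_pos|].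
  apply pow_incr; split; auto.
  pose proof (exp_ineq1_le (s / s0 - 1)).
  replace s with (s0 * (1 + (s / s0 - 1))) at 1 by (field; lra).
  apply Rmult_le_compat_l; lra.
Qed.

Lemma exp_sqr_half (y : R) : 0 <= y -> sqrt (1 + y) <= exp (y / 2).
Proof.
  intros Hy. rewrite <- (sqrt_pow2 (exp (y / 2))) by (left; apply exp_pos).
  apply sqrt_le_1_alt. simpl. rewrite Rmult_1_r, <- exp_plus.
  replace (y / 2 + y / 2) with y by field. apply exp_ineq1_le.
Qed.

(** Induction in place of Stirling's formula: for [n > 0] consecutive mode values have the ratio
    [((n + 1) / n) ^ n * exp (- 1)], at most [exp (- / (2 * (n + 1)))], which in turn is at most the
    ratio [sqrt (n + 1) / sqrt (n + 2)] of the right-hand sides. *)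
Lemma poisson_mode (n : nat) : poisson n (INR n) <= / sqrt (INR n + 1).
Proof.
  induction n as [|n IH].
  { unfold poisson; simpl. rewrite Ropp_0, exp_0, Rplus_0_l, sqrt_1. lra. }
  assert (H0 : 0 <= INR n) by apply pos_INR.
  assert (Hr : poisson (S n) (INR (S n)) =
    (INR n + 1) ^ n * exp (- INR n) / INR (fact n) * exp (- (1))).
  { unfold poisson. rewrite fact_simpl, mult_INR, S_INR, Ropp_plus_distr, exp_plus.
    simpl pow. field. split; [apply INR_fact_neq_0|lra]. }
  assert (Hp : (INR n + 1) ^ n <= INR n ^ n * exp (1 - / (2 * (INR n + 1)))).
  { destruct n as [|k].
    - simpl. rewrite <- exp_0 at 1. rewrite Rmult_1_l. apply exp_le_compat.
      replace (0 + 1) with 1 by ring. lra.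
    - set (N := INR (S k)) in *. assert (0 < N) by (apply lt_0_INR; lia).
      replace (N + 1) with (N * ((N + 1) / N)) at 1 by (field; lra).
      rewrite Rpow_mult_distr. apply Rmult_le_compat_l; [apply pow_le; lra|].
      assert (Hw : 1 <= (N + 1) / N).
      { replace ((N + 1) / N) with (1 + / N) by (field; lra).
        assert (0 < / N) by (apply Rinv_0_lt_compat; lra). lra. }
      rewrite <- (exp_ln ((N + 1) / N)) at 1 by lra.
      rewrite <- exp_mult_INR. fold N. apply exp_le_compat.
      pose proof (ln_le_half_diff _ Hw).
      apply Rle_trans with (N * (((N + 1) / N - / ((N + 1) / N)) / 2));
        [apply Rmult_le_compat_l; lra|].
      right; field; lra. }
  rewrite Hr, S_INR.
  assert (Hs : sqrt (INR n + 1 + 1) <= sqrt (INR n + 1) * exp (/ (2 * (INR n + 1)))).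
  { replace (INR n + 1 + 1) with ((INR n + 1) * (1 + / (INR n + 1))) by (field; lra).
    rewrite sqrt_mult; try lra.
    2: assert (0 < / (INR n + 1)) by (apply Rinv_0_lt_compat; lra); lra.
    apply Rmult_le_compat_l; [apply sqrt_pos|].
    replace (/ (2 * (INR n + 1))) with (/ (INR n + 1) / 2) by (field; lra).
    apply exp_sqr_half. left; apply Rinv_0_lt_compat; lra. }
  set (a := exp (/ (2 * (INR n + 1)))) in *. assert (Ha : 0 < a) by apply exp_pos.
  assert (Hq : 0 < sqrt (INR n + 1)) by (apply sqrt_lt_R0; lra).
  assert (Hq2 : 0 < sqrt (INR n + 1 + 1)) by (apply sqrt_lt_R0; lra).
  apply Rle_trans with (/ (sqrt (INR n + 1) * a)); [|apply Rinv_le_contravar; auto].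
  rewrite Rinv_mult.
  apply Rle_trans with (poisson n (INR n) * / a).
  2: { apply Rmult_le_compat_r; auto. left; apply Rinv_0_lt_compat; auto. }
  unfold poisson.
  assert (He : exp (1 - / (2 * (INR n + 1))) = exp 1 * / a).
  { unfold Rminus; rewrite exp_plus, exp_Ropp; auto. }
  rewrite He in Hp.
  assert (H1 : exp 1 * exp (- (1)) = 1) by (rewrite <- exp_plus, Rplus_opp_r; apply exp_0).
  replace (INR n ^ n * exp (- INR n) / INR (fact n) * / a) with
    ((INR n ^ n * (exp 1 * / a)) * (exp (- INR n) / INR (fact n) * exp (- (1))))
    by (replace (INR n ^ n * exp (- INR n) / INR (fact n) * / a) with
      (INR n ^ n * exp (- INR n) / INR (fact n) * / a * (exp 1 * exp (- (1)))) by (rewrite H1; ring);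
      unfold Rdiv; ring).
  replace ((INR n + 1) ^ n * exp (- INR n) / INR (fact n) * exp (- (1))) with
    ((INR n + 1) ^ n * (exp (- INR n) / INR (fact n) * exp (- (1)))) by (unfold Rdiv; ring).
  apply Rmult_le_compat_r; auto.
  apply Rmult_le_pos; [apply Rmult_le_pos|]; try (left; apply exp_pos).
  left; apply Rinv_0_lt_compat, INR_fact_lt_0.
Qed.

Lemma poisson_le (n : nat) (s : R) : 0 <= s -> poisson n s <= / sqrt (INR n + 1).
Proof.
  intros Hs. destruct n as [|n].
  - unfold poisson; simpl. rewrite Rplus_0_l, sqrt_1, Rinv_1.
    assert (exp (- s) <= exp 0) by (apply exp_le_compat; lra). rewrite exp_0 in *. lra.
  - apply Rle_trans with (2 := poisson_mode (S n)).
    assert (0 < INR (S n)) by (apply lt_0_INR; lia).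
    apply Rle_trans with (1 := poisson_tangent (S n) s (INR (S n)) Hs H).
    replace (- ((1 - INR (S n) / INR (S n)) * (s - INR (S n)))) with 0 by (field; lra).
    rewrite exp_0. lra.
Qed.

Lemma poisson_le_1 (n : nat) (s : R) : 0 <= s -> poisson n s <= 1.
Proof.
  intros Hs. apply Rle_trans with (1 := poisson_le n s Hs).
  rewrite <- Rinv_1 at 2. apply Rinv_le_contravar; [lra|].
  rewrite <- sqrt_1 at 1. apply sqrt_le_1_alt. pose proof (pos_INR n). lra.
Qed.

Lemma pow_exp_le (k : nat) (x t : R) : 0 < x -> 0 <= t ->
  t ^ k * exp (- x * t) <= INR (fact k) / x ^ k.
Proof.
  intros Hx Ht.
  assert (0 < x ^ k) by (apply pow_lt; auto).
  pose proof (INR_fact_lt_0 k).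
  replace (t ^ k * exp (- x * t)) with (poisson k (x * t) * (INR (fact k) / x ^ k)).
  - rewrite <- (Rmult_1_l (INR (fact k) / x ^ k)) at 2.
    apply Rmult_le_compat_r; [apply Rlt_le, Rdiv_lt_0_compat; auto|].
    apply poisson_le_1; nra.
  - unfold poisson. rewrite Rpow_mult_distr.
    replace (- (x * t)) with (- x * t) by ring. field. lra.
Qed.

(** * The weight and the derivatives of [K0] as moments *)

Lemma sqrt_weight_pos (t : R) : 1 < t -> 0 < sqrt (t ^ 2 - 1).
Proof. intros Ht; apply sqrt_lt_R0; nra. Qed.

Lemma sqrt_weight_le (t : R) : 1 < t -> sqrt (t ^ 2 - 1) <= t.
Proof.
  intros Ht. rewrite <- (sqrt_pow2 t) at 2 by lra. apply sqrt_le_1_alt; lra.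
Qed.

Lemma sqrt_weight_sqr (t : R) : 1 < t -> sqrt (t ^ 2 - 1) * sqrt (t ^ 2 - 1) = t ^ 2 - 1.
Proof. intros Ht; apply sqrt_sqrt; nra. Qed.

(** With [q = sqrt (t ^ 2 - 1)] the claim is [t ^ 2 <= 1 + t * q], that is [q ^ 2 <= t * q]. The
    first term carries the singularity at 1, the second the slow decay at infinity. *)
Lemma weight_split (t : R) : 1 < t ->
  / sqrt (t ^ 2 - 1) <= / (t ^ 2 * sqrt (t ^ 2 - 1)) + / t.
Proof.
  intros Ht. pose proof (sqrt_weight_pos t Ht). pose proof (sqrt_weight_le t Ht).
  pose proof (sqrt_weight_sqr t Ht). set (q := sqrt (t ^ 2 - 1)) in *.
  apply Rmult_le_reg_l with (t ^ 2 * q); [nra|].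
  replace (t ^ 2 * q * / q) with (t ^ 2) by (field; lra).
  replace (t ^ 2 * q * (/ (t ^ 2 * q) + / t)) with (1 + t * q) by (field; lra).
  nra.
Qed.

Lemma weight_primitive (t : R) : 1 < t ->
  is_derive (fun t => sqrt (t ^ 2 - 1) / t) t (/ (t ^ 2 * sqrt (t ^ 2 - 1))).
Proof.
  intros Ht. pose proof (sqrt_weight_pos t Ht).
  pose proof (sqrt_weight_sqr t Ht).
  auto_derive; [split; [nra|lra]|].
  replace (t * (t * 1) + - (1)) with (t ^ 2 - 1) by ring.
  set (q := sqrt (t ^ 2 - 1)) in *.
  field_simplify_eq; [|lra].
  replace (q ^ 2) with (q * q) by ring. nra.
Qed.

Lemma weight_primitive_bounds (t : R) : 1 < t -> 0 <= sqrt (t ^ 2 - 1) / t <= 1.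
Proof.
  intros Ht. pose proof (sqrt_weight_pos t Ht). pose proof (sqrt_weight_le t Ht).
  split.
  - apply Rlt_le, Rdiv_lt_0_compat; lra.
  - apply Rmult_le_reg_r with t; [lra|]. unfold Rdiv. rewrite Rmult_assoc, Rinv_l; lra.
Qed.

Definition bessel_integrand (k : nat) (x t : R) : R :=
  t ^ k * exp (- x * t) / sqrt (t ^ 2 - 1).

Definition bessel_moment (k : nat) (x : R) : R :=
  RInt_gen (V := R_CompleteNormedModule) (bessel_integrand k x)
    (at_right 1) (Rbar_locally p_infty).

Lemma bessel_integrand_continuous (k : nat) (x t : R) : 1 < t ->
  continuous (bessel_integrand k x) t.
Proof.
  intros Ht. pose proof (sqrt_weight_pos t Ht).
  apply @ex_derive_continuous. unfold bessel_integrand. auto_derive.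
  replace (t * (t * 1) + - (1)) with (t ^ 2 - 1) by ring.
  split; [nra|split; [lra|auto]].
Qed.

Lemma bessel_moment_newton (k : nat) (x : R) : 0 < x ->
  newton_int (bessel_integrand k x) (bessel_moment k x).
Proof.
  intros Hx.
  (* [M] bounds [t ^ k * exp (- x * t)]. [M'] bounds the same with one more power of [t], which
     turns the non-integrable [/ t] into [/ t ^ 2]. *)
  set (M := INR (fact k) / x ^ k). set (M' := INR (fact (S k)) / x ^ S k).
  assert (HM : 0 < M) by (apply Rdiv_lt_0_compat; [apply INR_fact_lt_0|apply pow_lt; auto]).
  assert (HM' : 0 < M') by (apply Rdiv_lt_0_compat; [apply INR_fact_lt_0|apply pow_lt; auto]).
  destruct (newton_int_exists (bessel_integrand k x)
    (fun t => M * / (t ^ 2 * sqrt (t ^ 2 - 1)) + M' * / t ^ 2)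
    (fun t => M * (sqrt (t ^ 2 - 1) / t) + M' * - / t) (- M') M) as [l Hl].
  - intros; apply bessel_integrand_continuous; auto.
  - intros t Ht. pose proof (sqrt_weight_pos t Ht). unfold bessel_integrand.
    assert (0 <= t ^ k * exp (- x * t))
      by (apply Rmult_le_pos; [apply pow_le; lra|left; apply exp_pos]).
    split.
    { apply Rmult_le_pos; auto. left; apply Rinv_0_lt_compat; auto. }
    apply Rle_trans with (t ^ k * exp (- x * t) * (/ (t ^ 2 * sqrt (t ^ 2 - 1)) + / t)).
    { apply Rmult_le_compat_l; auto. apply weight_split; auto. }
    rewrite Rmult_plus_distr_l. apply Rplus_le_compat.
    + apply Rmult_le_compat_r; [left; apply Rinv_0_lt_compat, Rmult_lt_0_compat; nra|].
      apply pow_exp_le; lra.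
    + replace (t ^ k * exp (- x * t) * / t) with (t ^ S k * exp (- x * t) * / t ^ 2)
        by (simpl; field; lra).
      apply Rmult_le_compat_r; [left; apply Rinv_0_lt_compat; nra|].
      apply pow_exp_le; lra.
  - intros t Ht.
    apply (is_derive_plus (fun t => M * (sqrt (t ^ 2 - 1) / t)) (fun t => M' * - / t) t
      (M * / (t ^ 2 * sqrt (t ^ 2 - 1))) (M' * / t ^ 2)).
    + apply (is_derive_scal (fun t => sqrt (t ^ 2 - 1) / t) t), weight_primitive; auto.
    + auto_derive; [lra|field; lra].
  - intros t Ht. pose proof (weight_primitive_bounds t Ht).
    assert (0 < / t <= 1).
    { split; [apply Rinv_0_lt_compat; lra|]. rewrite <- Rinv_1. apply Rinv_le_contravar; lra. }
    set (y := sqrt (t ^ 2 - 1) / t) in *. split; nra.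
  - replace (bessel_moment k x) with l; auto.
    symmetry. unfold bessel_moment. apply newton_int_RInt_gen; auto.
    intros; apply bessel_integrand_continuous; auto.
Qed.

Lemma K0_bessel_moment (x : R) : 0 < x -> K0 x = bessel_moment 0 x.
Proof.
  intros Hx.
  assert (E : forall t, bessel_integrand 0 x t = exp (- x * t) / sqrt (t ^ 2 - 1))
    by (intros t; unfold bessel_integrand; rewrite pow_O, Rmult_1_l; auto).
  unfold K0. apply newton_int_RInt_gen.
  - intros t Ht. apply continuous_ext with (1 := E).
    apply bessel_integrand_continuous; auto.
  - apply newton_int_ext with (bessel_integrand 0 x); [auto|].
    apply bessel_moment_newton; auto.
Qed.

Lemma exp_taylor1 (y : R) : Rabs (exp y - 1 - y) <= y ^ 2 * exp (Rabs y).
Proof.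
  pose proof (exp_ineq1_le y) as H1. rewrite Rabs_pos_eq by lra.
  assert (H2 : exp y - 1 <= y * exp y).
  { pose proof (exp_ineq1_le (- y)). pose proof (exp_pos y).
    assert (exp y * exp (- y) = 1) by (rewrite <- exp_plus, Rplus_opp_r; apply exp_0).
    nra. }
  destruct (Rle_dec 0 y) as [Hy|Hy].
  - rewrite Rabs_pos_eq by lra. nra.
  - assert (1 <= exp (Rabs y)).
    { pose proof (exp_ineq1_le (Rabs y)). pose proof (Rabs_pos y). lra. }
    assert (exp y - 1 - y <= y ^ 2) by nra.
    assert (0 <= y ^ 2) by apply pow2_ge_0. nra.
Qed.

(** Differentiation under the integral sign with an explicit remainder: the second-order error of
    [exp (- h * t)] is at most [(h * t) ^ 2 * exp (|h| * t)], and half of the decay [exp (- x * t)]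
    absorbs that exponential when [|h| <= x / 2]. What is left is [h ^ 2] times the moment of order
    [k + 2] at [x / 2]. *)
Lemma bessel_moment_derive (k : nat) (x : R) : 0 < x ->
  is_derive (bessel_moment k) x (- bessel_moment (S k) x).
Proof.
  intros Hx. apply is_derive_Reals.
  assert (Hx2 : 0 < x / 2) by lra.
  set (M := bessel_moment (S (S k)) (x / 2)).
  assert (Hrem : forall h, Rabs h <= x / 2 ->
    Rabs (bessel_moment k (x + h) - bessel_moment k x + h * bessel_moment (S k) x) <= h ^ 2 * M).
  { intros h Hh.
    assert (Hxh : 0 < x + h) by (apply Rabs_le_between in Hh; lra).
    assert (Hn := newton_int_lincomb 1 h _ _ _ _
      (newton_int_lincomb 1 (-1) _ _ _ _ (bessel_moment_newton k (x + h) Hxh)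
        (bessel_moment_newton k x Hx))
      (bessel_moment_newton (S k) x Hx)).
    assert (HM := newton_int_lincomb (h ^ 2) 0 _ _ _ _
      (bessel_moment_newton (S (S k)) (x / 2) Hx2) (bessel_moment_newton k x Hx)).
    fold M in HM.
    assert (Hp : forall t, 1 < t ->
      Rabs (1 * (1 * bessel_integrand k (x + h) t + -1 * bessel_integrand k x t)
          + h * bessel_integrand (S k) x t) <=
      h ^ 2 * bessel_integrand (S (S k)) (x / 2) t + 0 * bessel_integrand k x t).
    { intros t Ht. unfold bessel_integrand.
      pose proof (sqrt_weight_pos t Ht) as Hq.
      replace (- (x + h) * t) with (- x * t + - h * t) by ring. rewrite exp_plus.
      set (q := sqrt (t ^ 2 - 1)) in *.
      replace (1 * (1 * (t ^ k * (exp (- x * t) * exp (- h * t)) / q) + -1 * (t ^ k * exp (- x * t) / q))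
        + h * (t ^ S k * exp (- x * t) / q))
        with (t ^ k / q * (exp (- x * t) * (exp (- h * t) - 1 - (- h * t)))) by (simpl; field; lra).
      assert (Hc : 0 <= t ^ k / q) by (apply Rmult_le_pos; [apply pow_le; lra|left; apply Rinv_0_lt_compat; auto]).
      replace (h ^ 2 * (t ^ S (S k) * exp (- (x / 2) * t) / q) + 0 * (t ^ k * exp (- x * t) / q))
        with (t ^ k / q * ((- h * t) ^ 2 * exp (- (x / 2) * t))) by (simpl; field; lra).
      rewrite Rabs_mult, (Rabs_pos_eq (t ^ k / q)) by auto.
      apply Rmult_le_compat_l; auto.
      rewrite Rabs_mult, (Rabs_pos_eq (exp (- x * t))) by (left; apply exp_pos).
      apply Rle_trans with (exp (- x * t) * ((- h * t) ^ 2 * exp (Rabs (- h * t)))).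
      { apply Rmult_le_compat_l; [left; apply exp_pos|apply exp_taylor1]. }
      replace (exp (- x * t) * ((- h * t) ^ 2 * exp (Rabs (- h * t))))
        with ((- h * t) ^ 2 * (exp (- x * t) * exp (Rabs (- h * t)))) by ring.
      apply Rmult_le_compat_l; [apply pow2_ge_0|].
      rewrite <- exp_plus. apply exp_le_compat.
      rewrite Rabs_mult, Rabs_Ropp, (Rabs_pos_eq t) by lra. nra. }
    apply Rabs_le. split.
    - assert (HM' := newton_int_lincomb (-1) 0 _ _ _ _ HM HM).
      assert (Hle := newton_int_le _ _ _ _ HM' Hn). enough (-1 * (h ^ 2 * M + 0 * bessel_moment k x) +
        0 * (h ^ 2 * M + 0 * bessel_moment k x) <= 1 * (1 * bessel_moment k (x + h) + -1 * bessel_moment k x) + h * bessel_moment (S k) x) by lra.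
      apply Hle. intros t Ht. specialize (Hp t Ht). apply Rabs_le_between in Hp. lra.
    - assert (Hle := newton_int_le _ _ _ _ Hn HM).
      enough (1 * (1 * bessel_moment k (x + h) + -1 * bessel_moment k x) + h * bessel_moment (S k) x
        <= h ^ 2 * M + 0 * bessel_moment k x) by lra.
      apply Hle. intros t Ht. specialize (Hp t Ht). apply Rabs_le_between in Hp. lra. }
  intros e He.
  assert (HK : 0 < Rabs M + 1) by (pose proof (Rabs_pos M); lra).
  assert (Hd : 0 < Rmin (x / 2) (e / (Rabs M + 1))).
  { apply Rmin_glb_lt; auto. apply Rdiv_lt_0_compat; auto. }
  exists (mkposreal _ Hd). simpl. intros h Hh0 Hh.
  assert (Hh1 : Rabs h <= x / 2) by (pose proof (Rmin_l (x / 2) (e / (Rabs M + 1))); lra).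
  assert (Hh2 : Rabs h < e / (Rabs M + 1)) by (pose proof (Rmin_r (x / 2) (e / (Rabs M + 1))); lra).
  specialize (Hrem h Hh1).
  replace ((bessel_moment k (x + h) - bessel_moment k x) / h - - bessel_moment (S k) x)
    with ((bessel_moment k (x + h) - bessel_moment k x + h * bessel_moment (S k) x) / h) by (field; auto).
  assert (Hah : 0 < Rabs h) by (apply Rabs_pos_lt; auto).
  unfold Rdiv at 1. rewrite Rabs_mult, Rabs_inv.
  apply Rmult_lt_reg_r with (Rabs h); auto. rewrite Rmult_assoc, Rinv_l, Rmult_1_r by lra.
  apply Rle_lt_trans with (1 := Hrem).
  assert (Rabs h * (Rabs M + 1) < e).
  { apply Rmult_lt_reg_r with (/ (Rabs M + 1)); [apply Rinv_0_lt_compat; auto|].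
    rewrite Rmult_assoc, Rinv_r, Rmult_1_r by lra. exact Hh2. }
  rewrite <- (pow2_abs h). pose proof (Rle_abs M).
  apply Rle_lt_trans with (Rabs h * (Rabs h * (Rabs M + 1))); [nra|].
  rewrite (Rmult_comm e). apply Rmult_lt_compat_l; auto.
Qed.

Lemma locally_pos (P : R -> Prop) (x : R) : 0 < x -> (forall y, 0 < y -> P y) -> locally x P.
Proof.
  intros Hx HP. apply (locally_interval _ x 0 p_infty); simpl; auto.
Qed.

Lemma Derive_n_K0 (n : nat) (x : R) : 0 < x ->
  Derive_n K0 n x = (-1) ^ n * bessel_moment n x.
Proof.
  revert x; induction n as [|n IH]; intros x Hx.
  - simpl. rewrite Rmult_1_l. apply K0_bessel_moment; auto.
  - simpl Derive_n. apply is_derive_unique.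
    apply is_derive_ext_loc with (fun y => (-1) ^ n * bessel_moment n y).
    { apply locally_pos; auto. intros y Hy; symmetry; apply IH; auto. }
    replace ((-1) ^ S n * bessel_moment (S n) x) with ((-1) ^ n * - bessel_moment (S n) x)
      by (simpl; ring).
    apply (is_derive_scal (bessel_moment n) x), bessel_moment_derive; auto.
Qed.

Definition scaled_moment (j : nat) (x : R) : R := x ^ j * bessel_moment j x.

Lemma omega_scaled_moment (n : nat) (x : R) : 0 < x ->
  omega n x = scaled_moment n x / INR (fact n).
Proof.
  intros Hx. unfold omega, scaled_moment. rewrite Derive_n_K0 by auto.
  rewrite <- Rmult_assoc, <- Rpow_mult_distr. do 3 f_equal. ring.
Qed.

Lemma pow_derive (j : nat) (x : R) : 0 < x ->
  is_derive (fun y => y ^ j) x (INR j * x ^ j / x).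
Proof.
  intros Hx. auto_derive; auto. destruct j; [simpl; field; lra|].
  simpl Nat.pred. simpl pow. field. lra.
Qed.

Lemma scaled_moment_derive (j : nat) (x : R) : 0 < x ->
  is_derive (scaled_moment j) x
    ((INR j * scaled_moment j x - scaled_moment (S j) x) / x).
Proof.
  intros Hx. unfold scaled_moment.
  replace ((INR j * (x ^ j * bessel_moment j x) - x ^ S j * bessel_moment (S j) x) / x)
    with (INR j * x ^ j / x * bessel_moment j x + x ^ j * - bessel_moment (S j) x)
    by (simpl; field; lra).
  apply (is_derive_mult (fun y => y ^ j) (bessel_moment j) x); [| |intros; apply Rmult_comm].
  - apply pow_derive; auto.
  - apply bessel_moment_derive; auto.
Qed.

Lemma pow_exp_derive (j : nat) (s : R) : 0 < s ->
  is_derive (fun s => s ^ j * exp (- s)) s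
    ((INR j * (s ^ j * exp (- s)) - s ^ S j * exp (- s)) / s).
Proof.
  intros Hs.
  replace ((INR j * (s ^ j * exp (- s)) - s ^ S j * exp (- s)) / s)
    with (INR j * s ^ j / s * exp (- s) + s ^ j * - exp (- s)) by (simpl; field; lra).
  apply (is_derive_mult (fun y => y ^ j) (fun s => exp (- s)) s); [| |intros; apply Rmult_comm].
  - apply pow_derive; auto.
  - auto_derive; auto. ring.
Qed.

(** * Taylor coefficients of [omega n] and of [poisson n] *)

(** Scaled coefficients [T m = y ^ m / m! * D^m f] satisfy [(m + 1) * T (m + 1) = y * (T m)' - m * T
    m]. On a combination of functions with [y * B j ' = j * B j - B (j + 1)] the right side
    multiplies the [j]-th coefficient by [j - m] and subtracts the one before it. *)
Fixpoint taylor_coef (n m j : nat) : R :=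
  match m with
  | O => if Nat.eqb j n then / INR (fact n) else 0
  | S m' => ((INR j - INR m') * taylor_coef n m' j
             - match j with O => 0 | S j' => taylor_coef n m' j' end) / INR (S m')
  end.

(* With [B j s = s ^ j * exp (- s)] this is [s ^ m / m! * D^m (poisson n)], and with
   [B = scaled_moment] it is [x ^ m / m! * D^m (omega n)]: both families obey
   [y * B j ' = j * B j - B (j + 1)]. *)
Definition taylor_comb (B : nat -> R -> R) (n m : nat) (y : R) : R :=
  sum_f_R0 (fun j => taylor_coef n m j * B j y) (n + m).

Lemma taylor_coef_zero (n m j : nat) : (n + m < j)%nat -> taylor_coef n m j = 0.
Proof.
  revert j; induction m as [|m IH]; intros j Hj; simpl.
  - destruct (Nat.eqb_spec j n); [lia|auto].
  - destruct j; [lia|]. rewrite !IH by lia. unfold Rdiv; ring.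
Qed.

Lemma taylor_comb_0 (B : nat -> R -> R) (n : nat) (y : R) :
  taylor_comb B n 0 y = B n y / INR (fact n).
Proof.
  unfold taylor_comb. rewrite Nat.add_0_r.
  destruct n as [|n].
  - simpl. field.
  - rewrite tech5. cbn [taylor_coef]. rewrite Nat.eqb_refl.
    rewrite (sum_eq _ (fun _ => 0)).
    + rewrite sum_cte. unfold Rdiv; ring.
    + intros i Hi. destruct (Nat.eqb_spec i (S n)); [lia|ring].
Qed.

Lemma is_derive_sum_f_R0 (f : nat -> R -> R) (df : nat -> R) (N : nat) (x : R) :
  (forall j, is_derive (f j) x (df j)) ->
  is_derive (fun y => sum_f_R0 (fun j => f j y) N) x (sum_f_R0 df N).
Proof.
  intros H. induction N as [|N IH]; simpl; auto.
  apply (is_derive_plus (fun y => sum_f_R0 (fun j => f j y) N) (f (S N)) x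
    (sum_f_R0 df N) (df (S N))); auto.
Qed.

Lemma taylor_comb_derive (B : nat -> R -> R) (n m : nat) (y : R) : 0 < y ->
  (forall j, is_derive (B j) y ((INR j * B j y - B (S j) y) / y)) ->
  is_derive (taylor_comb B n m) y
    ((INR m * taylor_comb B n m y + INR (S m) * taylor_comb B n (S m) y) / y).
Proof.
  intros Hy HB.
  (* The index shift leaves a boundary term at [S N]; it vanishes for [N = n + m] because the
     coefficients stop there. *)
  assert (E : forall N, INR (S m) * sum_f_R0 (fun j => taylor_coef n (S m) j * B j y) (S N) =
    sum_f_R0 (fun j => taylor_coef n m j * ((INR j - INR m) * B j y - B (S j) y)) N
    + (INR (S N) - INR m) * taylor_coef n m (S N) * B (S N) y).
  { assert (Hm : INR (S m) <> 0) by (apply not_0_INR; lia).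
    assert (Hc : forall j, INR (S m) * (taylor_coef n (S m) (S j) * B (S j) y) =
      ((INR (S j) - INR m) * taylor_coef n m (S j) - taylor_coef n m j) * B (S j) y).
    { intros j. cbn [taylor_coef]. field; auto. }
    induction N as [|N IH].
    - cbn [sum_f_R0]. rewrite Rmult_plus_distr_l, Hc. cbn [taylor_coef].
      replace (INR 0) with 0 by reflexivity. field. auto.
    - rewrite tech5, Rmult_plus_distr_l, IH, Hc, tech5. ring. }
  set (D := sum_f_R0 (fun j => taylor_coef n m j * ((INR j * B j y - B (S j) y) / y)) (n + m)).
  assert (HD : is_derive (taylor_comb B n m) y D).
  { unfold taylor_comb. apply is_derive_sum_f_R0 with (f := fun j y => taylor_coef n m j * B j y).
    intros j. apply (is_derive_scal (B j) y); auto. }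
  replace ((INR m * taylor_comb B n m y + INR (S m) * taylor_comb B n (S m) y) / y) with D; auto.
  unfold taylor_comb at 2. rewrite Nat.add_succ_r, E, taylor_coef_zero by lia.
  unfold D, taylor_comb. rewrite scal_sum, Rmult_0_r, Rmult_0_l, Rplus_0_r, <- plus_sum.
  unfold Rdiv at 2. rewrite Rmult_comm, scal_sum. apply sum_eq. intros j _. field. lra.
Qed.

Definition omega_taylor (n m : nat) (x : R) : R := taylor_comb scaled_moment n m x.

Lemma omega_taylor_0 (n : nat) (x : R) : 0 < x -> omega_taylor n 0 x = omega n x.
Proof.
  intros Hx. unfold omega_taylor. rewrite taylor_comb_0, omega_scaled_moment; auto.
Qed.

Lemma omega_taylor_derive (n m : nat) (x : R) : 0 < x ->
  is_derive (omega_taylor n m) x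
    ((INR m * omega_taylor n m x + INR (S m) * omega_taylor n (S m) x) / x).
Proof.
  intros Hx. apply taylor_comb_derive; auto. intros; apply scaled_moment_derive; auto.
Qed.

Lemma Derive_n_omega (n m : nat) (x : R) : 0 < x ->
  Derive_n (omega n) m x = INR (fact m) * omega_taylor n m x / x ^ m.
Proof.
  revert x; induction m as [|m IH]; intros x Hx.
  - simpl. rewrite omega_taylor_0 by auto. field.
  - simpl Derive_n. apply is_derive_unique.
    apply is_derive_ext_loc with (fun y => INR (fact m) * (omega_taylor n m y * / y ^ m)).
    { apply locally_pos; auto. intros y Hy. rewrite IH by auto. match goal with |- @eq _ ?a ?b => change (@eq R a b) end. unfold Rdiv; ring. }
    assert (Hp : x ^ m <> 0) by (apply pow_nonzero; lra).
    replace (INR (fact (S m)) * omega_taylor n (S m) x / x ^ S m) with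
      (INR (fact m) * ((INR m * omega_taylor n m x + INR (S m) * omega_taylor n (S m) x) / x * / x ^ m
        + omega_taylor n m x * (- (INR m * x ^ m / x) / (x ^ m) ^ 2))).
    2: { rewrite fact_simpl, mult_INR, S_INR. simpl pow. field. repeat split; try lra; auto. }
    apply (is_derive_scal (fun y => omega_taylor n m y * / y ^ m) x).
    apply (is_derive_mult (omega_taylor n m) (fun y => / y ^ m) x); [| |intros; apply Rmult_comm].
    + apply omega_taylor_derive; auto.
    + apply (is_derive_inv (fun y => y ^ m) x); auto. apply pow_derive; auto.
Qed.

Lemma scaled_moment_newton (j : nat) (x : R) : 0 < x ->
  newton_int (fun t => (x * t) ^ j * exp (- (x * t)) / sqrt (t ^ 2 - 1)) (scaled_moment j x).
Proof.
  intros Hx. unfold scaled_moment.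
  replace (x ^ j * bessel_moment j x) with (x ^ j * bessel_moment j x + 0 * bessel_moment j x) by ring.
  apply newton_int_ext with
    (fun t => x ^ j * bessel_integrand j x t + 0 * bessel_integrand j x t).
  - intros t Ht. unfold bessel_integrand. rewrite Rpow_mult_distr.
    replace (- (x * t)) with (- x * t) by ring. unfold Rdiv; ring.
  - apply newton_int_lincomb; apply bessel_moment_newton; auto.
Qed.

Lemma omega_newton (n : nat) (x : R) : 0 < x ->
  newton_int (fun t => poisson n (x * t) / sqrt (t ^ 2 - 1)) (omega n x).
Proof.
  intros Hx. rewrite omega_scaled_moment by auto.
  replace (scaled_moment n x / INR (fact n))
    with (/ INR (fact n) * scaled_moment n x + 0 * scaled_moment n x) by (unfold Rdiv; ring).
  eapply newton_int_ext; [|apply newton_int_lincomb; apply scaled_moment_newton; auto].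
  intros t Ht. unfold poisson. cbv beta. unfold Rdiv. ring.
Qed.

(** * Laguerre polynomials and the tilting bound *)

Definition poisson_taylor (n m : nat) (s : R) : R :=
  taylor_comb (fun j s => s ^ j * exp (- s)) n m s.

Lemma omega_taylor_newton (n m : nat) (x : R) : 0 < x ->
  newton_int (fun t => poisson_taylor n m (x * t) / sqrt (t ^ 2 - 1)) (omega_taylor n m x).
Proof.
  intros Hx. unfold poisson_taylor, omega_taylor, taylor_comb.
  induction (n + m)%nat as [|N IH].
  - cbn [sum_f_R0].
    replace (taylor_coef n m 0 * scaled_moment 0 x) with
      (taylor_coef n m 0 * scaled_moment 0 x + 0 * scaled_moment 0 x) by ring.
    eapply newton_int_ext; [|apply newton_int_lincomb; apply scaled_moment_newton; auto].
    intros t Ht. cbv beta. unfold Rdiv. ring.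
  - cbn [sum_f_R0].
    match goal with |- newton_int _ (?a + ?b * ?c) =>
      replace (a + b * c) with (1 * a + b * c) by ring end.
    eapply newton_int_ext; [|apply newton_int_lincomb; [exact IH|apply scaled_moment_newton; auto]].
    intros t Ht. cbv beta. unfold Rdiv. ring.
Qed.

(* The coefficient of [w ^ m] in [(1 + w) ^ n * exp (- s * w)], i.e. the Laguerre
   polynomial [L_m^(n - m)] at [s]. *)
Fixpoint laguerre (n m : nat) (s : R) : R :=
  match m with
  | O => 1
  | S m' => ((INR n - s - INR m') * laguerre n m' s
             - s * match m' with O => 0 | S m'' => laguerre n m'' s end) / INR (S m')
  end.

Definition laguerre_prev (n m : nat) (s : R) : R :=
  match m with O => 0 | S m' => laguerre n m' s end.

(** With [G = (1 + w) ^ n * exp (- s * w)], this compares coefficients of [w ^ m] in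
    [(1 + w) * G' = (n - s - s * w) * G]. *)
Lemma laguerre_S (n m : nat) (s : R) :
  INR (S m) * laguerre n (S m) s =
  (INR n - s - INR m) * laguerre n m s - s * laguerre_prev n m s.
Proof.
  assert (INR (S m) <> 0) by (apply not_0_INR; lia).
  change (laguerre n (S m) s) with
    (((INR n - s - INR m) * laguerre n m s - s * laguerre_prev n m s) / INR (S m)).
  field; auto.
Qed.

(** Reflects [dG/ds = - w * G] for the generating function. The recurrence reaches back two orders,
    so the induction carries two consecutive ones. *)
Lemma laguerre_derive (n m : nat) (s : R) :
  is_derive (laguerre n m) s (- laguerre_prev n m s).
Proof.
  enough (is_derive (laguerre n m) s (- laguerre_prev n m s) /\
    is_derive (laguerre n (S m)) s (- laguerre n m s)) by tauto.
  induction m as [|m [IH0 IH1]].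
  - split.
    + simpl. rewrite Ropp_0. apply @is_derive_const.
    + simpl. auto_derive; auto. field.
  - split; [exact IH1|].
    assert (Hm : INR (S (S m)) <> 0) by (apply not_0_INR; lia).
    replace (- laguerre n (S m) s) with (/ INR (S (S m)) *
      (((- 1) * laguerre n (S m) s + (INR n - s - INR (S m)) * - laguerre n m s)
       - (1 * laguerre n m s + s * - laguerre_prev n m s))).
    2: { pose proof (laguerre_S n m s) as E. rewrite S_INR in *. rewrite S_INR in *.
         assert (INR m + 1 + 1 <> 0) by auto.
         apply Rmult_eq_reg_l with (INR m + 1 + 1); auto.
         rewrite <- Rmult_assoc, Rinv_r, Rmult_1_l by auto. lra. }
    apply is_derive_ext with (fun s => / INR (S (S m)) *
      ((INR n - s - INR (S m)) * laguerre n (S m) s - s * laguerre n m s)).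
    { intros t. change (laguerre n (S (S m)) t) with
       (((INR n - t - INR (S m)) * laguerre n (S m) t - t * laguerre n m t) / INR (S (S m))).
      match goal with |- @eq _ ?a ?b => change (@eq R a b) end. field; auto. }
    apply (is_derive_scal (fun s => (INR n - s - INR (S m)) * laguerre n (S m) s - s * laguerre n m s) s).
    apply (is_derive_minus (fun s => (INR n - s - INR (S m)) * laguerre n (S m) s)
      (fun s => s * laguerre n m s) s).
    + apply (is_derive_mult (fun s => INR n - s - INR (S m)) (laguerre n (S m)) s);
        [| exact IH1 |intros; apply Rmult_comm].
      auto_derive; auto; ring.
    + apply (is_derive_mult (fun s => s) (laguerre n m) s);
        [| exact IH0 |intros; apply Rmult_comm].
      apply @is_derive_id.
Qed.

Lemma poisson_derive (n : nat) (s : R) : 0 < s ->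
  is_derive (poisson n) s ((INR n - s) * poisson n s / s).
Proof.
  intros Hs. unfold poisson.
  replace ((INR n - s) * (s ^ n * exp (- s) / INR (fact n)) / s) with
    (/ INR (fact n) * ((INR n * (s ^ n * exp (- s)) - s ^ S n * exp (- s)) / s)).
  2: { simpl pow. field. split; [apply INR_fact_neq_0|lra]. }
  apply is_derive_ext with (fun s => / INR (fact n) * (s ^ n * exp (- s))).
  { intros t. apply Rmult_comm. }
  apply (is_derive_scal (fun s => s ^ n * exp (- s)) s). apply pow_exp_derive; auto.
Qed.

(** Behind it is [poisson n ((1 + w) * s) / poisson n s = (1 + w) ^ n * exp (- s * w)].
    Differentiating both forms of order [m] and comparing determines order [m + 1]. *)
Lemma poisson_taylor_laguerre (n m : nat) (s : R) : 0 < s ->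
  poisson_taylor n m s = poisson n s * laguerre n m s.
Proof.
  revert s; induction m as [|m IH]; intros s Hs.
  - unfold poisson_taylor. rewrite taylor_comb_0. simpl. unfold poisson. ring.
  - assert (H1 := taylor_comb_derive (fun j s => s ^ j * exp (- s)) n m s Hs
      (fun j => pow_exp_derive j s Hs)).
    fold (poisson_taylor n m s) (poisson_taylor n (S m) s) in H1.
    assert (H2 : is_derive (taylor_comb (fun j s => s ^ j * exp (- s)) n m) s
      ((INR n - s) * poisson n s / s * laguerre n m s + poisson n s * - laguerre_prev n m s)).
    { apply is_derive_ext_loc with (fun s => poisson n s * laguerre n m s).
      - apply locally_pos; auto. intros y Hy; symmetry; apply IH; auto.
      - apply (is_derive_mult (poisson n) (laguerre n m) s); [| |intros; apply Rmult_comm].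
        + apply poisson_derive; auto.
        + apply laguerre_derive. }
    apply is_derive_unique in H1. apply is_derive_unique in H2. rewrite H1 in H2.
    rewrite IH in H2 by auto.
    assert (Hm : INR (S m) <> 0) by (apply not_0_INR; lia).
    apply Rmult_eq_reg_l with (INR (S m)); auto.
    replace (INR (S m) * (poisson n s * laguerre n (S m) s)) with
      (poisson n s * (INR (S m) * laguerre n (S m) s)) by ring.
    rewrite laguerre_S.
    assert (E : INR (S m) * poisson_taylor n (S m) s =
      s * ((INR m * (poisson n s * laguerre n m s) + INR (S m) * poisson_taylor n (S m) s) / s)
      - INR m * (poisson n s * laguerre n m s)) by (field; lra).
    rewrite E, H2. field. lra.
Qed.

(* The polynomials [P N w], sums of [|laguerre n j s| * w ^ j] over [j <= N], satisfy
   [P' <= (d + s * w) / (1 - w) * P] with [d = |n - s|], by the three-term recurrence. *)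
Lemma laguerre_bound (n m : nat) (s r : R) : 0 < s -> 0 <= r <= / 2 ->
  Rabs (laguerre n m s) * r ^ m <=
  exp (Rabs (INR n - s) * r + (Rabs (INR n - s) + s) * r ^ 2).
Proof.
  intros Hs Hr. set (d := Rabs (INR n - s)).
  assert (Hd : 0 <= d) by apply Rabs_pos.
  set (L := fun j => Rabs (laguerre n j s)).
  assert (HL : forall j, 0 <= L j) by (intros; apply Rabs_pos).
  assert (HL0 : L 0%nat = 1) by (unfold L; simpl; apply Rabs_R1).
  assert (HL1 : L 1%nat = d).
  { unfold L, d. f_equal. simpl. field. }
  assert (HLS : forall j, INR (S (S j)) * L (S (S j)) <= (d + INR (S j)) * L (S j) + s * L j).
  { intros j. unfold L.
    rewrite <- (Rabs_pos_eq (INR (S (S j)))), <- Rabs_mult, laguerre_S by apply pos_INR.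
    unfold Rminus at 1. apply Rle_trans with (1 := Rabs_triang _ _).
    rewrite Rabs_Ropp, !Rabs_mult, (Rabs_pos_eq s) by lra.
    apply Rplus_le_compat; [|apply Rle_refl].
    apply Rmult_le_compat_r; [apply Rabs_pos|].
    unfold Rminus at 1. apply Rle_trans with (1 := Rabs_triang _ _).
    rewrite Rabs_Ropp, (Rabs_pos_eq (INR (S j))) by apply pos_INR. apply Rle_refl. }
  set (P := fun N w => sum_f_R0 (fun j => L j * w ^ j) N).
  set (Q := fun N w => sum_f_R0 (fun j => L j * (INR j * w ^ pred j)) N).
  assert (HPQ : forall N w, is_derive (P N) w (Q N w)).
  { intros N w. unfold P, Q. apply is_derive_sum_f_R0 with (f := fun j w => L j * w ^ j).
    intros j. apply (is_derive_scal (fun w => w ^ j) w). auto_derive; auto. ring. }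
  assert (HP0 : forall N, P N 0 = 1).
  { intros N. unfold P. induction N as [|N IH]; cbn [sum_f_R0].
    - rewrite HL0. simpl. ring.
    - rewrite IH. simpl. ring. }
  assert (HPpos : forall N w, 0 <= w -> 0 <= P N w).
  { intros N w Hw. apply cond_pos_sum. intros j. apply Rmult_le_pos; auto. apply pow_le; auto. }
  (* The subtracted term is the top term of [s * w * P N w], which has no counterpart on the left;
     keeping it lets the induction on [N] close. *)
  assert (HrecQ : forall N w, 0 <= w ->
    Q (S N) w <= d * P N w + w * Q N w + s * w * P N w - s * L N * w ^ S N).
  { intros N w Hw. induction N as [|N IH].
    - unfold P, Q; cbn [sum_f_R0]. rewrite HL0, HL1. simpl. lra.
    - assert (HQ : Q (S (S N)) w = Q (S N) w + L (S (S N)) * (INR (S (S N)) * w ^ S N)) by reflexivity.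
      assert (HP : P (S N) w = P N w + L (S N) * w ^ S N) by reflexivity.
      assert (HQ' : Q (S N) w = Q N w + L (S N) * (INR (S N) * w ^ N)) by reflexivity.
      rewrite HQ, HP. pose proof (HLS N) as H.
      assert (Hw' : 0 <= w ^ S N) by (apply pow_le; auto).
      apply (Rmult_le_compat_r (w ^ S N)) in H; auto.
      replace (w ^ S (S N)) with (w * w ^ S N) by reflexivity.
      replace (w * Q (S N) w) with (w * Q N w + L (S N) * INR (S N) * w ^ S N)
        by (rewrite HQ'; simpl; ring).
      lra. }
  (* For [w <= / 2] the quotient [(d + s * w) / (1 - w)] is at most this affine rate, whose
     primitive [d * w + (d + s) * w ^ 2] is the exponent in the claim. *)
  assert (HQ : forall N w, 0 <= w <= / 2 -> Q N w <= (d + 2 * (d + s) * w) * P N w).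
  { intros N w Hw.
    assert (H : (1 - w) * Q N w <= (d + s * w) * P N w).
    { destruct N as [|N].
      - unfold P, Q; cbn [sum_f_R0]. rewrite HL0. simpl. nra.
      - pose proof (HrecQ N w ltac:(lra)).
        assert (P N w <= P (S N) w).
        { unfold P; cbn [sum_f_R0]. assert (0 <= L (S N) * w ^ S N); [|lra].
          apply Rmult_le_pos; auto. apply pow_le; lra. }
        assert (Q N w <= Q (S N) w).
        { unfold Q; cbn [sum_f_R0]. assert (0 <= L (S N) * (INR (S N) * w ^ pred (S N))); [|lra].
          repeat apply Rmult_le_pos; auto; [apply pos_INR|apply pow_le; lra]. }
        assert (0 <= s * L N * w ^ S N)
          by (apply Rmult_le_pos; [apply Rmult_le_pos; auto; lra|apply pow_le; lra]).
        assert (d * P N w <= d * P (S N) w) by (apply Rmult_le_compat_l; auto).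
        assert (w * Q N w <= w * Q (S N) w) by (apply Rmult_le_compat_l; lra).
        assert (s * w * P N w <= s * w * P (S N) w) by (apply Rmult_le_compat_l; [nra|lra]).
        lra. }
    assert (H2 : (d + s * w) <= (1 - w) * (d + 2 * (d + s) * w)).
    { assert (0 <= (d + s) * w * (1 - 2 * w)) by (repeat apply Rmult_le_pos; lra). nra. }
    pose proof (HPpos N w ltac:(lra)).
    apply Rmult_le_reg_l with (1 - w); [lra|].
    apply Rle_trans with (1 := H). rewrite <- Rmult_assoc.
    apply Rmult_le_compat_r; auto. }
  set (H := fun w => d * w + (d + s) * w ^ 2).
  (* Gronwall's argument: [P m * exp (- H)] does not increase and equals 1 at 0. *)
  assert (HE : P m r * exp (- H r) - P m 0 * exp (- H 0) <= 0 - 0).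
  { apply (derive_le_increment (fun w => P m w * exp (- H w))
      (fun w => Q m w * exp (- H w) + P m w * (- (d + 2 * (d + s) * w) * exp (- H w)))
      (fun _ => 0) (fun _ => 0)); [lra| | |].
    - intros w Hw. apply (is_derive_mult (P m) (fun w => exp (- H w)) w); [apply HPQ| |intros; apply Rmult_comm].
      unfold H. auto_derive; auto. simpl. ring.
    - intros; apply @is_derive_const.
    - intros w Hw. pose proof (HQ m w ltac:(lra)). pose proof (exp_pos (- H w)).
      assert ((Q m w - (d + 2 * (d + s) * w) * P m w) * exp (- H w) <= 0) by nra. lra. }
  rewrite HP0 in HE. replace (- H 0) with 0 in HE by (unfold H; ring). rewrite exp_0 in HE.
  assert (HPr : P m r <= exp (H r)).
  { apply Rmult_le_reg_r with (exp (- H r)); [apply exp_pos|].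
    rewrite <- exp_plus, Rplus_opp_r, exp_0. lra. }
  apply Rle_trans with (2 := HPr). unfold P.
  destruct m as [|k]; cbn [sum_f_R0]; [apply Rle_refl|].
  assert (0 <= sum_f_R0 (fun j => L j * r ^ j) k) by (apply HPpos; lra).
  fold (L (S k)). lra.
Qed.

(** Exponential tilting: [exp (- b * s)] rescales the exponential of the density, and each of the
    [n] factors [exp b] is traded for [1 + b] at the price [exp (2 * b ^ 2)]. The total price is
    bounded as long as [n * b ^ 2] is. *)
Lemma poisson_tilt (n : nat) (s b : R) : 0 <= s -> -1/2 <= b ->
  poisson n s * exp (- b * (s - INR n)) <= exp (INR n * (b ^ 2 * 2)) * poisson n ((1 + b) * s).
Proof.
  intros Hs Hb. unfold poisson.
  replace (- b * (s - INR n)) with (- (b * s) + INR n * b) by ring.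
  replace (- ((1 + b) * s)) with (- s + - (b * s)) by ring.
  rewrite !exp_plus, !exp_mult_INR, Rpow_mult_distr.
  assert (H : exp b ^ n <= (exp (b ^ 2 * 2) * (1 + b)) ^ n).
  { apply pow_incr. split; [left; apply exp_pos|].
    pose proof (Rinv_le_exp b Hb) as Hi. rewrite exp_plus in Hi.
    assert (exp b * exp (- b) = 1) by (rewrite <- exp_plus, Rplus_opp_r; apply exp_0).
    apply (Rmult_le_compat_l ((1 + b) * exp b)) in Hi.
    2: { apply Rmult_le_pos; [lra|left; apply exp_pos]. }
    replace ((1 + b) * exp b * / (1 + b)) with (exp b) in Hi by (field; lra).
    apply Rle_trans with (1 := Hi). right.
    transitivity ((1 + b) * exp (b ^ 2 * 2) * (exp b * exp (- b))); [ring|].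
    rewrite H. ring. }
  rewrite Rpow_mult_distr in H.
  replace (s ^ n * exp (- s) / INR (fact n) * (exp (- (b * s)) * exp b ^ n)) with
    (s ^ n * exp (- s) * / INR (fact n) * exp (- (b * s)) * exp b ^ n) by (unfold Rdiv; ring).
  replace (exp (b ^ 2 * 2) ^ n * ((1 + b) ^ n * s ^ n * (exp (- s) * exp (- (b * s))) / INR (fact n)))
    with (s ^ n * exp (- s) * / INR (fact n) * exp (- (b * s)) * (exp (b ^ 2 * 2) ^ n * (1 + b) ^ n))
    by (unfold Rdiv; ring).
  apply Rmult_le_compat_l; auto.
  repeat apply Rmult_le_pos; try (left; apply exp_pos); [apply pow_le; auto|].
  left; apply Rinv_0_lt_compat, INR_fact_lt_0.
Qed.

Lemma exp_half_le_2 : exp (1 / 2) <= 2.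
Proof.
  pose proof (exp_ineq1_le (- (1 / 2))).
  assert (exp (1 / 2) * exp (- (1 / 2)) = 1) by (rewrite <- exp_plus, Rplus_opp_r; apply exp_0).
  pose proof (exp_pos (1 / 2)). nra.
Qed.

(* [3 / 2] times the radius [/ (4 * sqrt (n + 1))]: at this radius the quadratic term of
   [laguerre_bound] is absorbed into the linear one. *)
Definition tilt (n : nat) : R := 3 / (8 * sqrt (INR n + 1)).

Lemma sqrt_succ_ge_1 (n : nat) : 1 <= sqrt (INR n + 1).
Proof.
  rewrite <- sqrt_1 at 1. apply sqrt_le_1_alt. pose proof (pos_INR n). lra.
Qed.

Lemma tilt_bounds (n : nat) : 0 < tilt n <= 3 / 8.
Proof.
  pose proof (sqrt_succ_ge_1 n). unfold tilt. split.
  - apply Rdiv_lt_0_compat; lra.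
  - apply Rmult_le_compat_l; [lra|]. apply Rinv_le_contravar; lra.
Qed.

Lemma tilt_sqr (n : nat) : INR n * tilt n ^ 2 <= 9 / 64.
Proof.
  pose proof (sqrt_succ_ge_1 n). unfold tilt. pose proof (pos_INR n).
  assert (E : sqrt (INR n + 1) ^ 2 = INR n + 1) by (rewrite pow2_sqrt; lra).
  replace (INR n * (3 / (8 * sqrt (INR n + 1))) ^ 2)
    with (9 / 64 * (INR n / sqrt (INR n + 1) ^ 2)) by (field; lra).
  rewrite E. rewrite <- (Rmult_1_r (9 / 64)) at 2. apply Rmult_le_compat_l; [lra|].
  apply Rmult_le_reg_r with (INR n + 1); [lra|]. unfold Rdiv. rewrite Rmult_assoc, Rinv_l; lra.
Qed.

(** [laguerre_bound] produces [exp (b * |s - n|)]; depending on the sign of [s - n] this is a tilt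
    by [b] or by [- b], and the sum on the right covers both. *)
Lemma poisson_taylor_bound (n m : nat) (s : R) : 0 < s ->
  Rabs (poisson_taylor n m s) <=
  2 * (4 * sqrt (INR n + 1)) ^ m *
    (poisson n ((1 - tilt n) * s) + poisson n ((1 + tilt n) * s)).
Proof.
  intros Hs. rewrite poisson_taylor_laguerre by auto.
  pose proof (sqrt_succ_ge_1 n) as Hq. pose proof (tilt_bounds n) as Hb.
  pose proof (tilt_sqr n) as Hb2. pose proof (pos_INR n) as Hn.
  assert (Hp := poisson_pos n s ltac:(lra)).
  rewrite Rabs_mult, (Rabs_pos_eq (poisson n s)) by auto.
  set (q := sqrt (INR n + 1)) in *. set (b := tilt n) in *.
  set (r := / (4 * q)). set (d := Rabs (INR n - s)).
  assert (Hr : 0 < r <= / 4).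
  { unfold r. split; [apply Rinv_0_lt_compat; lra|]. apply Rinv_le_contravar; lra. }
  assert (Hbr : b = 3 / 2 * r) by (unfold b, tilt, r; fold q; field; lra).
  assert (HL := laguerre_bound n m s r Hs ltac:(lra)). fold d in HL.
  assert (Hd : 0 <= d) by apply Rabs_pos.
  assert (Hsd : s <= INR n + d).
  { unfold d. pose proof (Rle_abs (- (INR n - s))). rewrite Rabs_Ropp in H. lra. }
  (* By [s <= n + d] the quadratic part is at most [n * r ^ 2 + 2 * d * r ^ 2]. The first summand is
     at most [1 / 16], the second at most [d * r / 2] because [r <= / 4]; this gives
     [b = 3 / 2 * r]. *)
  assert (Hexp : d * r + (d + s) * r ^ 2 <= b * d + 1 / 16).
  { assert (INR n * r ^ 2 <= 1 / 16) by (rewrite Hbr in Hb2; nra).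
    assert (s * r ^ 2 <= (INR n + d) * r ^ 2) by (apply Rmult_le_compat_r; [apply pow2_ge_0|auto]).
    assert (d * r ^ 2 <= d * r * / 4) by (replace (d * r ^ 2) with (d * r * r) by ring; apply Rmult_le_compat_l; [nra|lra]).
    rewrite Hbr. lra. }
  assert (Hrm : 0 < r ^ m) by (apply pow_lt; lra).
  assert (Hpow : (4 * q) ^ m = / r ^ m) by (unfold r; rewrite <- pow_inv, Rinv_inv; auto).
  assert (HL' : Rabs (laguerre n m s) <= (4 * q) ^ m * exp (b * d + 1 / 16)).
  { rewrite Hpow. apply Rmult_le_reg_r with (r ^ m); auto.
    apply Rle_trans with (1 := HL).
    replace (/ r ^ m * exp (b * d + 1 / 16) * r ^ m) with (exp (b * d + 1 / 16)) by (field; lra).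
    apply exp_le_compat; auto. }
  assert (H4 : 0 < (4 * q) ^ m) by (apply pow_lt; lra).
  apply Rle_trans with (poisson n s * ((4 * q) ^ m * exp (b * d + 1 / 16))).
  { apply Rmult_le_compat_l; auto. }
  rewrite exp_plus.
  replace (poisson n s * ((4 * q) ^ m * (exp (b * d) * exp (1 / 16)))) with
    ((4 * q) ^ m * (exp (1 / 16) * (poisson n s * exp (b * d)))) by ring.
  replace (2 * (4 * q) ^ m * (poisson n ((1 - b) * s) + poisson n ((1 + b) * s))) with
    ((4 * q) ^ m * (2 * (poisson n ((1 - b) * s) + poisson n ((1 + b) * s)))) by ring.
  apply Rmult_le_compat_l; [lra|].
  assert (Hm1 : 0 <= poisson n ((1 - b) * s)) by (apply poisson_pos; nra).
  assert (Hm2 : 0 <= poisson n ((1 + b) * s)) by (apply poisson_pos; nra).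
  assert (Hone : exists y, y <= poisson n ((1 - b) * s) + poisson n ((1 + b) * s) /\ 0 <= y /\
     poisson n s * exp (b * d) <= exp (9 / 32) * y).
  { assert (Hc : exp (INR n * (b ^ 2 * 2)) <= exp (9 / 32)) by (apply exp_le_compat; lra).
    unfold d. destruct (Rle_dec s (INR n)).
    - exists (poisson n ((1 + b) * s)). split; [lra|split; auto].
      rewrite Rabs_pos_eq by lra.
      replace (b * (INR n - s)) with (- b * (s - INR n)) by ring.
      apply Rle_trans with (1 := poisson_tilt n s b ltac:(lra) ltac:(lra)).
      apply Rmult_le_compat_r; auto.
    - exists (poisson n ((1 - b) * s)). split; [lra|split; auto].
      rewrite Rabs_left1 by lra.
      replace (b * - (INR n - s)) with (- - b * (s - INR n)) by ring.
      apply Rle_trans with (1 := poisson_tilt n s (- b) ltac:(lra) ltac:(lra)).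
      replace (1 + - b) with (1 - b) by ring. replace ((- b) ^ 2) with (b ^ 2) by ring.
      apply Rmult_le_compat_r; auto. }
  destruct Hone as [y [Hy1 [Hy2 Hy3]]].
  apply Rle_trans with (exp (1 / 16) * (exp (9 / 32) * y)).
  { apply Rmult_le_compat_l; auto. left; apply exp_pos. }
  rewrite <- Rmult_assoc, <- exp_plus.
  (* [1 / 16] is left over from the exponent and [9 / 32] is the price of the tilt; a sum below
     [1 / 2] yields the factor 2. *)
  assert (exp (1 / 16 + 9 / 32) <= 2).
  { apply Rle_trans with (2 := exp_half_le_2). apply exp_le_compat; lra. }
  nra.
Qed.

(** * Bounds on [omega n] and their transfer to its Taylor coefficients *)

Lemma omega_nonneg (n : nat) (x : R) : 0 < x -> 0 <= omega n x.
Proof.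
  intros Hx. assert (E := newton_int_lincomb 0 0 _ _ _ _ (omega_newton n x Hx) (omega_newton n x Hx)).
  assert (Hle := newton_int_le _ _ _ _ E (omega_newton n x Hx)).
  enough (0 * omega n x + 0 * omega n x <= omega n x) by lra.
  apply Hle. intros t Ht. rewrite !Rmult_0_l, Rplus_0_l.
  apply Rmult_le_pos; [apply poisson_pos; nra|].
  left; apply Rinv_0_lt_compat, sqrt_weight_pos; auto.
Qed.

Lemma omega_taylor_bound (n m : nat) (x : R) : 0 < x ->
  Rabs (omega_taylor n m x) <=
  2 * (4 * sqrt (INR n + 1)) ^ m *
    (omega n ((1 - tilt n) * x) + omega n ((1 + tilt n) * x)).
Proof.
  intros Hx. pose proof (tilt_bounds n) as Hb. set (b := tilt n) in *.
  set (K := 2 * (4 * sqrt (INR n + 1)) ^ m).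
  assert (H1 := omega_newton n ((1 - b) * x) ltac:(nra)).
  assert (H2 := omega_newton n ((1 + b) * x) ltac:(nra)).
  assert (HR := newton_int_lincomb K K _ _ _ _ H1 H2).
  assert (HT := omega_taylor_newton n m x Hx).
  assert (Hpt : forall t, 1 < t -> Rabs (poisson_taylor n m (x * t) / sqrt (t ^ 2 - 1)) <=
    K * (poisson n ((1 - b) * x * t) / sqrt (t ^ 2 - 1)) +
    K * (poisson n ((1 + b) * x * t) / sqrt (t ^ 2 - 1))).
  { intros t Ht. pose proof (sqrt_weight_pos t Ht).
    unfold Rdiv at 1. rewrite Rabs_mult, (Rabs_pos_eq (/ _)) by (left; apply Rinv_0_lt_compat; auto).
    assert (Hp := poisson_taylor_bound n m (x * t) ltac:(nra)). fold K b in Hp.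
    rewrite <- !Rmult_assoc in Hp.
    apply Rle_trans with (K * (poisson n ((1 - b) * x * t) + poisson n ((1 + b) * x * t)) * / sqrt (t ^ 2 - 1)).
    - apply Rmult_le_compat_r; auto. left; apply Rinv_0_lt_compat; auto.
    - right; unfold Rdiv; ring. }
  rewrite Rmult_plus_distr_l. apply Rabs_le. split.
  - assert (HR' := newton_int_lincomb (-1) 0 _ _ _ _ HR HR).
    assert (Hle := newton_int_le _ _ _ _ HR' HT).
    match type of Hle with _ -> ?a <= ?b => enough (a <= b) by lra end.
    apply Hle. intros t Ht. specialize (Hpt t Ht). apply Rabs_le_between in Hpt. lra.
  - apply (newton_int_le _ _ _ _ HT HR). intros t Ht. specialize (Hpt t Ht).
    apply Rabs_le_between in Hpt. lra.
Qed.

Lemma poisson_S (k : nat) (s : R) : INR (S k) * poisson (S k) s = s * poisson k s.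
Proof.
  unfold poisson. rewrite fact_simpl, mult_INR. simpl pow. field.
  split; [apply INR_fact_neq_0|apply not_0_INR; lia].
Qed.

(** The derivatives [poisson (j - 1) - poisson j] telescope. The sum is the Poisson distribution
    function (a regularised incomplete gamma function), hence a primitive bounded by 1. *)
Lemma poisson_sum_derive (k : nat) (s : R) : 0 < s ->
  is_derive (fun s => sum_f_R0 (fun j => poisson j s) k) s (- poisson k s).
Proof.
  intros Hs. induction k as [|k IH]; cbn [sum_f_R0].
  - replace (- poisson 0 s) with ((INR 0 - s) * poisson 0 s / s) by (simpl; field; lra).
    apply poisson_derive; auto.
  - replace (- poisson (S k) s) with (- poisson k s + (INR (S k) - s) * poisson (S k) s / s).
    + apply (is_derive_plus (fun s => sum_f_R0 (fun j => poisson j s) k) (poisson (S k)) s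
        (- poisson k s) ((INR (S k) - s) * poisson (S k) s / s)); auto.
      apply poisson_derive; auto.
    + rewrite Rmult_minus_distr_r, poisson_S. field. lra.
Qed.

Lemma poisson_sum_bounds (k : nat) (s : R) : 0 <= s ->
  0 <= sum_f_R0 (fun j => poisson j s) k <= 1.
Proof.
  intros Hs. split.
  - apply cond_pos_sum. intros; apply poisson_pos; auto.
  - rewrite (sum_eq _ (fun j => s ^ j / INR (fact j) * exp (- s)))
      by (intros; unfold poisson, Rdiv; ring).
    rewrite <- scal_sum.
    apply Rle_trans with (exp (- s) * exp s).
    + apply Rmult_le_compat_l; [left; apply exp_pos|]. apply exp_ge_taylor; auto.
    + rewrite <- exp_plus, Rplus_opp_l, exp_0. lra.
Qed.

(** On the [/ t] part of the weight, [poisson n (x * t) / t] equals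
    [x / n * poisson (n - 1) (x * t)], whose primitive in [t] is [- / n] times a Poisson sum; this
    contributes [/ n] for every [x]. The other part contributes the maximum of the density. *)
Lemma omega_le (n : nat) (x : R) : (0 < n)%nat -> 0 < x ->
  omega n x <= / sqrt (INR n + 1) + / INR n.
Proof.
  intros Hn Hx. destruct n as [|k]; [lia|].
  assert (HN : 0 < INR (S k)) by (apply lt_0_INR; lia).
  assert (Hi : 0 < / INR (S k)) by (apply Rinv_0_lt_compat; auto).
  set (M := / sqrt (INR (S k) + 1)).
  replace (M + / INR (S k)) with (M - - / INR (S k)) by ring.
  apply (newton_int_le_primitive _
    (fun t => M * / (t ^ 2 * sqrt (t ^ 2 - 1)) + - / INR (S k) * (x * - poisson k (x * t)))
    (fun t => M * (sqrt (t ^ 2 - 1) / t) + - / INR (S k) * sum_f_R0 (fun j => poisson j (x * t)) k)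
    _ _ _ (omega_newton (S k) x Hx)).
  - intros t Ht.
    apply (is_derive_plus (fun t => M * (sqrt (t ^ 2 - 1) / t))
      (fun t => - / INR (S k) * sum_f_R0 (fun j => poisson j (x * t)) k) t
      (M * / (t ^ 2 * sqrt (t ^ 2 - 1))) (- / INR (S k) * (x * - poisson k (x * t)))).
    + apply (is_derive_scal (fun t => sqrt (t ^ 2 - 1) / t) t), weight_primitive; auto.
    + apply (is_derive_scal (fun t => sum_f_R0 (fun j => poisson j (x * t)) k) t).
      apply (is_derive_comp (fun s => sum_f_R0 (fun j => poisson j s) k) (fun t => x * t) t).
      * apply poisson_sum_derive; nra.
      * auto_derive; auto; ring.
  - intros t Ht. pose proof (weight_primitive_bounds t Ht).
    pose proof (poisson_sum_bounds k (x * t) ltac:(nra)).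
    assert (0 < M) by (apply Rinv_0_lt_compat; pose proof (sqrt_succ_ge_1 (S k)); lra).
    set (y := sqrt (t ^ 2 - 1) / t) in *.
    set (z := sum_f_R0 (fun j => poisson j (x * t)) k) in *.
    split; nra.
  - intros t Ht. pose proof (sqrt_weight_pos t Ht).
    assert (Hp := poisson_pos (S k) (x * t) ltac:(nra)).
    assert (Hl := poisson_le (S k) (x * t) ltac:(nra)). fold M in Hl.
    apply Rle_trans with (poisson (S k) (x * t) * (/ (t ^ 2 * sqrt (t ^ 2 - 1)) + / t)).
    { apply Rmult_le_compat_l; auto. apply weight_split; auto. }
    rewrite Rmult_plus_distr_l. apply Rplus_le_compat.
    + apply Rmult_le_compat_r; auto. left; apply Rinv_0_lt_compat.
      apply Rmult_lt_0_compat; nra.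
    + right. pose proof (poisson_S k (x * t)) as E.
      replace (- / INR (S k) * (x * - poisson k (x * t))) with
        (/ INR (S k) * (x * t * poisson k (x * t)) * / t) by (field; lra).
      rewrite <- E. field. lra.
Qed.

Lemma omega_le_3 (n : nat) (x : R) : (0 < n)%nat -> 0 < x ->
  omega n x <= 3 / sqrt (INR n + 1).
Proof.
  intros Hn Hx. apply Rle_trans with (1 := omega_le n x Hn Hx).
  pose proof (sqrt_succ_ge_1 n).
  assert (HN : 1 <= INR n) by (apply (le_INR 1); lia).
  assert (E : sqrt (INR n + 1) * sqrt (INR n + 1) = INR n + 1) by (apply sqrt_sqrt; lra).
  set (q := sqrt (INR n + 1)) in *.
  enough (/ INR n <= 2 / q) by (unfold Rdiv in *; lra).
  apply Rmult_le_reg_r with (INR n * q); [nra|].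
  replace (/ INR n * (INR n * q)) with q by (field; lra).
  replace (2 / q * (INR n * q)) with (2 * INR n) by (field; lra). nra.
Qed.

(** For [n = 0] the [/ t] part is unbounded as [x] tends to 0. After
    [exp (- x * t) <= / (x * t + 1)] it has the primitive [- ln (1 + / (x * t))], the source of the
    logarithm. *)
Lemma omega_0_le (x : R) : 0 < x -> omega 0 x <= 1 + ln ((x + 1) / x).
Proof.
  intros Hx.
  replace (1 + ln ((x + 1) / x)) with (1 - - ln ((x + 1) / x)) by ring.
  apply (newton_int_le_primitive _
    (fun t => / (t ^ 2 * sqrt (t ^ 2 - 1)) + / (t * (x * t + 1)))
    (fun t => sqrt (t ^ 2 - 1) / t + - ln (1 + / (x * t)))
    _ _ _ (omega_newton 0 x Hx)).
  - intros t Ht.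
    apply (is_derive_plus (fun t => sqrt (t ^ 2 - 1) / t) (fun t => - ln (1 + / (x * t))) t
      (/ (t ^ 2 * sqrt (t ^ 2 - 1))) (/ (t * (x * t + 1)))).
    + apply weight_primitive; auto.
    + assert (0 < x * t) by nra. assert (0 < / (x * t)) by (apply Rinv_0_lt_compat; auto).
      auto_derive; [repeat split; lra|]. field. repeat split; lra.
  - intros t Ht. pose proof (weight_primitive_bounds t Ht).
    assert (0 < x * t) by nra. assert (0 < / (x * t)) by (apply Rinv_0_lt_compat; auto).
    assert (0 <= ln (1 + / (x * t))) by (rewrite <- ln_1; apply ln_le; lra).
    assert (ln (1 + / (x * t)) <= ln ((x + 1) / x)).
    { apply ln_le; [lra|]. replace ((x + 1) / x) with (1 + / x) by (field; lra).
      apply Rplus_le_compat_l, Rinv_le_contravar; nra. }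
    lra.
  - intros t Ht. pose proof (sqrt_weight_pos t Ht). assert (0 < x * t) by nra.
    assert (Hp := poisson_pos 0 (x * t) ltac:(lra)).
    apply Rle_trans with (poisson 0 (x * t) * (/ (t ^ 2 * sqrt (t ^ 2 - 1)) + / t)).
    { apply Rmult_le_compat_l; auto. apply weight_split; auto. }
    rewrite Rmult_plus_distr_l. apply Rplus_le_compat.
    + rewrite <- (Rmult_1_l (/ (t ^ 2 * _))) at 2.
      apply Rmult_le_compat_r; [|apply poisson_le_1; lra]. left; apply Rinv_0_lt_compat.
      apply Rmult_lt_0_compat; nra.
    + replace (/ (t * (x * t + 1))) with (/ (x * t + 1) * / t) by (field; lra).
      apply Rmult_le_compat_r; [left; apply Rinv_0_lt_compat; lra|].
      unfold poisson. simpl. rewrite Rmult_1_l, Rdiv_1_r, exp_Ropp.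
      apply Rinv_le_contravar; [lra|]. pose proof (exp_ineq1_le (x * t)). lra.
Qed.

(** The tangent at [x0] has rate [c = 1 - n / x0], and [x0 >= n + 1] means [c * x0 >= 1]. So along
    [s = y * t] the decay is at least [exp (- (t - 1))], and each part of the split weight
    integrates to at most 1, which gives the factor 2. *)
Lemma omega_tail (n : nat) (x0 y : R) : INR n + 1 <= x0 <= y ->
  omega n y <= 2 * (poisson n x0 * exp (- ((1 - INR n / x0) * (y - x0)))).
Proof.
  intros H. pose proof (pos_INR n) as Hn.
  set (c := 1 - INR n / x0). set (D := poisson n x0 * exp (- (c * (y - x0)))).
  assert (Hc : c * x0 = x0 - INR n) by (unfold c; field; lra).
  assert (Hc0 : 0 < c) by (apply Rmult_lt_reg_r with x0; lra).
  assert (HD : 0 <= D).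
  { apply Rmult_le_pos; [apply poisson_pos; lra|left; apply exp_pos]. }
  replace (2 * D) with (D - - D) by ring.
  apply (newton_int_le_primitive _
    (fun t => D * (/ (t ^ 2 * sqrt (t ^ 2 - 1)) + exp (- (t - 1))))
    (fun t => D * (sqrt (t ^ 2 - 1) / t + - exp (- (t - 1))))
    _ _ _ (omega_newton n y ltac:(lra))).
  - intros t Ht. apply (is_derive_scal (fun t => sqrt (t ^ 2 - 1) / t + - exp (- (t - 1))) t).
    apply (is_derive_plus (fun t => sqrt (t ^ 2 - 1) / t) (fun t => - exp (- (t - 1))) t
      (/ (t ^ 2 * sqrt (t ^ 2 - 1))) (exp (- (t - 1)))).
    + apply weight_primitive; auto.
    + auto_derive; auto. unfold Rminus. ring.
  - intros t Ht. pose proof (weight_primitive_bounds t Ht).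
    pose proof (exp_pos (- (t - 1))).
    assert (exp (- (t - 1)) <= exp 0) by (apply exp_le_compat; lra). rewrite exp_0 in *.
    set (z := sqrt (t ^ 2 - 1) / t) in *. split; nra.
  - intros t Ht. pose proof (sqrt_weight_pos t Ht).
    assert (Hyt : 0 <= y * t) by nra.
    assert (Hi : 0 < / (t ^ 2 * sqrt (t ^ 2 - 1)))
      by (apply Rinv_0_lt_compat, Rmult_lt_0_compat; nra).
    assert (Hp : poisson n (y * t) <= D * exp (- (t - 1))).
    { apply Rle_trans with (1 := poisson_tangent n (y * t) x0 Hyt ltac:(lra)). fold c.
      unfold D. rewrite Rmult_assoc, <- exp_plus.
      apply Rmult_le_compat_l; [apply poisson_pos; lra|]. apply exp_le_compat.
      assert (c * x0 <= c * y) by (apply Rmult_le_compat_l; lra).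
      assert (1 * (t - 1) <= c * y * (t - 1)) by (apply Rmult_le_compat_r; lra).
      lra. }
    apply Rle_trans with (D * exp (- (t - 1)) * (/ (t ^ 2 * sqrt (t ^ 2 - 1)) + / t)).
    { apply Rmult_le_compat; auto.
      - apply poisson_pos; auto.
      - left; apply Rinv_0_lt_compat; auto.
      - apply weight_split; auto. }
    rewrite Rmult_assoc. apply Rmult_le_compat_l; auto.
    assert (exp (- (t - 1)) <= exp 0) by (apply exp_le_compat; lra). rewrite exp_0 in *.
    pose proof (exp_pos (- (t - 1))).
    assert (0 < / t <= 1).
    { split; [apply Rinv_0_lt_compat; lra|]. rewrite <- Rinv_1. apply Rinv_le_contravar; lra. }
    nra.
Qed.

(** This is [omega_tail] at [x0 = n + sqrt n], where [1 - n / x0 = / (1 + sqrt n)]. For [n = 0] that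
    point would be 0, and 1 takes its place. *)
Lemma omega_exponential_decay (n : nat) (x : R) :
  Rmax 1 (INR n + sqrt (INR n)) <= x ->
  Rabs (omega n x) <=
    3 * (exp (sqrt (INR n) - x / (1 + sqrt (INR n))) / sqrt (INR n + 1)).
Proof.
  intros Hx.
  assert (H1 : 1 <= x) by (apply Rle_trans with (2 := Hx); apply Rmax_l).
  assert (H2 : INR n + sqrt (INR n) <= x) by (apply Rle_trans with (2 := Hx); apply Rmax_r).
  rewrite Rabs_pos_eq by (apply omega_nonneg; lra).
  destruct n as [|k].
  - assert (H := omega_tail 0 1 x). simpl INR in H.
    apply Rle_trans with (1 := H ltac:(lra)). unfold poisson. simpl.
    rewrite sqrt_0, Rplus_0_l, sqrt_1.
    replace (1 * exp (- (1)) / 1 * exp (- ((1 - 0 / 1) * (x - 1)))) with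
      (exp (- (1)) * exp (- ((1 - 0 / 1) * (x - 1)))) by field.
    rewrite <- exp_plus.
    replace (- (1) + - ((1 - 0 / 1) * (x - 1))) with (- x) by field.
    replace (0 - x / (1 + 0)) with (- x) by field.
    pose proof (exp_pos (- x)). lra.
  - set (N := INR (S k)) in *.
    assert (HN : 1 <= N) by (apply (le_INR 1); lia).
    assert (Hq : 1 <= sqrt N) by (rewrite <- sqrt_1 at 1; apply sqrt_le_1_alt; auto).
    assert (E : sqrt N * sqrt N = N) by (apply sqrt_sqrt; lra).
    assert (H := omega_tail (S k) (N + sqrt N) x ltac:(fold N; lra)). fold N in H.
    apply Rle_trans with (1 := H).
    replace (- ((1 - N / (N + sqrt N)) * (x - (N + sqrt N)))) with (sqrt N - x / (1 + sqrt N)).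
    2: { set (q := sqrt N) in *. rewrite <- E. field. split; nra. }
    assert (Hp := poisson_le (S k) (N + sqrt N) ltac:(lra)). fold N in Hp.
    pose proof (exp_pos (sqrt N - x / (1 + sqrt N))).
    assert (0 < / sqrt (N + 1)) by (apply Rinv_0_lt_compat, sqrt_lt_R0; lra).
    unfold Rdiv at 3. nra.
Qed.

(** * The general estimate *)

(** Serves the case [n = 0 < m]: there the tilting bound would return values of [omega 0], and with
    them a logarithm that the estimate does not allow. *)
Lemma omega_taylor_0_m (m : nat) (x : R) : 0 < x ->
  omega_taylor 0 m x = (-1) ^ m * omega m x.
Proof.
  intros Hx. assert (H := Derive_n_omega 0 m x Hx).
  rewrite (Derive_n_ext (omega 0) K0) in H
    by (intros t; unfold omega; simpl; field).
  rewrite Derive_n_K0 in H by auto.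
  rewrite omega_scaled_moment by auto. unfold scaled_moment.
  assert (Hp : x ^ m <> 0) by (apply pow_nonzero; lra).
  pose proof (INR_fact_neq_0 m).
  apply Rmult_eq_reg_l with (INR (fact m) / x ^ m).
  2: { apply Rmult_integral_contrapositive; split; auto. apply Rinv_neq_0_compat; auto. }
  transitivity (INR (fact m) * omega_taylor 0 m x / x ^ m); [field; auto|].
  rewrite <- H. field. auto.
Qed.

Lemma omega_taylor_general (n m : nat) (x : R) : 0 < x -> (0 < n + m)%nat ->
  Rabs (omega_taylor n m x) <= (12 * sqrt (INR n + 1)) ^ m * (12 / sqrt (INR n + 1)).
Proof.
  intros Hx Hnm. destruct (Nat.eq_dec n 0) as [->|Hn].
  - rewrite omega_taylor_0_m, Rabs_mult, pow_1_abs, Rmult_1_l by auto.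
    simpl INR. rewrite Rplus_0_l, sqrt_1, Rmult_1_r, Rdiv_1_r.
    rewrite Rabs_pos_eq by (apply omega_nonneg; auto).
    apply Rle_trans with (1 := omega_le_3 m x ltac:(lia) Hx).
    pose proof (sqrt_succ_ge_1 m).
    assert (1 <= 12 ^ m) by (apply pow_R1_Rle; lra).
    assert (3 / sqrt (INR m + 1) <= 3).
    { assert (/ sqrt (INR m + 1) <= / 1) by (apply Rinv_le_contravar; lra).
      rewrite Rinv_1 in *. unfold Rdiv. lra. }
    lra.
  - pose proof (tilt_bounds n). pose proof (sqrt_succ_ge_1 n).
    apply Rle_trans with (1 := omega_taylor_bound n m x Hx).
    assert (H1 := omega_le_3 n ((1 - tilt n) * x) ltac:(lia) ltac:(nra)).
    assert (H2 := omega_le_3 n ((1 + tilt n) * x) ltac:(lia) ltac:(nra)).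
    set (q := sqrt (INR n + 1)) in *.
    (* Two values of [omega n], each at most [3 / q], times 2 make [12 / q]; the base 4 is then
       enlarged to 12 so that a single constant serves. *)
    apply Rle_trans with (2 * (4 * q) ^ m * (6 / q)).
    { apply Rmult_le_compat_l; [|unfold Rdiv in *; lra].
      apply Rmult_le_pos; [lra|apply pow_le; lra]. }
    replace (2 * (4 * q) ^ m * (6 / q)) with ((4 * q) ^ m * (12 / q)) by (field; lra).
    apply Rmult_le_compat_r; [apply Rlt_le, Rdiv_lt_0_compat; lra|].
    apply pow_incr; lra.
Qed.

Lemma Derive_n_omega_le (n m : nat) (x g B : R) : 0 < x ->
  Rabs (omega_taylor n m x) <= g ^ m * B ->
  Rabs (Derive_n (omega n) m x) <= INR (fact m) * (g / x) ^ m * B.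
Proof.
  intros Hx H. rewrite Derive_n_omega by auto.
  pose proof (INR_fact_lt_0 m). assert (0 < x ^ m) by (apply pow_lt; auto).
  unfold Rdiv. rewrite !Rabs_mult, Rabs_inv, (Rabs_pos_eq (INR (fact m))), (Rabs_pos_eq (x ^ m)) by lra.
  rewrite Rpow_mult_distr, pow_inv.
  replace (INR (fact m) * (g ^ m * / x ^ m) * B) with
    (INR (fact m) * (g ^ m * B) * / x ^ m) by ring.
  apply Rmult_le_compat_r; [left; apply Rinv_0_lt_compat; auto|].
  apply Rmult_le_compat_l; lra.
Qed.

Lemma ln_succ_div_nonneg (x : R) : 0 < x -> 0 <= ln ((x + 1) / x).
Proof.
  intros Hx. rewrite <- ln_1. apply ln_le; [lra|].
  replace ((x + 1) / x) with (1 + / x) by (field; lra).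
  assert (0 < / x) by (apply Rinv_0_lt_compat; auto). lra.
Qed.

Lemma kronecker_nonneg (i j : nat) : 0 <= kronecker i j.
Proof. unfold kronecker. destruct (Nat.eqb i j); lra. Qed.

Lemma bracket_ge (n m k : nat) (x g : R) : 0 < x -> 0 <= g ->
  g / sqrt (INR n + 1) <=
  kronecker m 0 / sqrt (2 * x + 1) +
    g / sqrt (INR n + 1) * (1 + kronecker k 0 * ln ((x + 1) / x)).
Proof.
  intros Hx Hg. pose proof (ln_succ_div_nonneg x Hx).
  pose proof (kronecker_nonneg k 0). pose proof (kronecker_nonneg m 0).
  pose proof (sqrt_succ_ge_1 n).
  assert (0 <= kronecker m 0 / sqrt (2 * x + 1)).
  { apply Rmult_le_pos; auto. left; apply Rinv_0_lt_compat, sqrt_lt_R0; lra. }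
  assert (0 <= g / sqrt (INR n + 1)).
  { apply Rmult_le_pos; auto. left; apply Rinv_0_lt_compat; lra. }
  assert (0 <= g / sqrt (INR n + 1) * (kronecker k 0 * ln ((x + 1) / x)))
    by (apply Rmult_le_pos; [|apply Rmult_le_pos]; auto).
  lra.
Qed.

Lemma omega_general_estimate (n m : nat) (x : R) : 0 < x ->
  Rabs (Derive_n (omega n) m x) <=
    INR (fact m) * (12 * sqrt (INR n + 1) / x) ^ m *
    (kronecker m 0 / sqrt (2 * x + 1) +
     12 / sqrt (INR n + 1) * (1 + kronecker (m + n) 0 * ln ((x + 1) / x))).
Proof.
  intros Hx. pose proof (sqrt_succ_ge_1 n).
  apply Derive_n_omega_le; auto.
  destruct (Nat.eq_dec (n + m) 0) as [E|E].
  - assert (n = 0%nat) as -> by lia. assert (m = 0%nat) as -> by lia.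
    rewrite omega_taylor_0, Rabs_pos_eq by (auto; apply omega_nonneg; auto).
    apply Rle_trans with (1 := omega_0_le x Hx).
    unfold kronecker; simpl. rewrite Rplus_0_l, sqrt_1.
    pose proof (ln_succ_div_nonneg x Hx).
    assert (0 < 1 / sqrt (2 * x + 1)) by (apply Rdiv_lt_0_compat; [lra|apply sqrt_lt_R0; lra]).
    lra.
  - apply Rle_trans with (1 := omega_taylor_general n m x Hx ltac:(lia)).
    apply Rmult_le_compat_l; [apply pow_le; lra|]. apply bracket_ge; lra.
Qed.

(** * Large arguments *)

(** A Chernoff-type bound: relative to the mode the exponent is [n * (ln (1 + z) - z)], and
    [ln_le_half_diff] bounds [ln (1 + z) - z] by [- z ^ 2 / (2 * (1 + z))]. The decay is Gaussian
    for [z <= 1] and exponential beyond. *)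
Lemma poisson_upper_tail (n : nat) (z : R) : 0 <= z ->
  poisson n (INR n * (1 + z)) <= exp (- (INR n * (z ^ 2 / (2 * (1 + z))))).
Proof.
  intros Hz.
  assert (H1 : 1 + z <= exp (z - z ^ 2 / (2 * (1 + z)))).
  { rewrite <- (exp_ln (1 + z)) at 1 by lra. apply exp_le_compat.
    apply Rle_trans with (1 := ln_le_half_diff (1 + z) ltac:(lra)).
    right; field; lra. }
  set (u := z ^ 2 / (2 * (1 + z))) in *.
  assert (Hp : poisson n (INR n * (1 + z)) <= poisson n (INR n) * exp (- u) ^ n).
  { unfold poisson. rewrite Rpow_mult_distr.
    replace (- (INR n * (1 + z))) with (- INR n + INR n * - z) by ring.
    rewrite exp_plus, exp_mult_INR.
    replace (INR n ^ n * (1 + z) ^ n * (exp (- INR n) * exp (- z) ^ n) / INR (fact n)) with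
      (INR n ^ n * exp (- INR n) / INR (fact n) * ((1 + z) * exp (- z)) ^ n)
      by (rewrite Rpow_mult_distr; unfold Rdiv; ring).
    apply Rmult_le_compat_l; [apply (poisson_pos n), pos_INR|].
    apply pow_incr. split; [apply Rmult_le_pos; [lra|left; apply exp_pos]|].
    replace (- u) with ((z - u) + - z) by ring. rewrite exp_plus.
    apply Rmult_le_compat_r; auto. left; apply exp_pos. }
  apply Rle_trans with (1 := Hp).
  replace (- (INR n * u)) with (INR n * - u) by ring. rewrite exp_mult_INR.
  rewrite <- (Rmult_1_l (exp (- u) ^ n)) at 2.
  apply Rmult_le_compat_r; [apply pow_le; left; apply exp_pos|].
  apply poisson_le_1, pos_INR.
Qed.

Lemma sqrt_pow_exp_ln (a : R) (m : nat) : 0 < a -> sqrt a ^ m = exp (INR m * (ln a / 2)).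
Proof.
  intros Ha. rewrite exp_mult_INR. f_equal.
  rewrite <- (sqrt_pow2 (exp (ln a / 2))) by (left; apply exp_pos). f_equal.
  simpl. rewrite Rmult_1_r, <- exp_plus. replace (ln a / 2 + ln a / 2) with (ln a) by field.
  symmetry; apply exp_ln; auto.
Qed.

(* If [k <= q] the Gaussian factor beats [(n + 1) ^ (m / 2)] because
   [ln (n + 1) <= (m - 1) / 2]; otherwise it decays like [exp (- m * q / 5)]. *)
Lemma sqrt_pow_gaussian_le (n m : nat) (q k : R) :
  q = sqrt (INR n) -> 1 <= q -> (2 <= m)%nat -> 1 + 2 * ln (INR n + 1) <= INR m ->
  k = INR m - 3 / 8 ->
  sqrt (INR n + 1) ^ m * exp (- (k ^ 2 * q / (2 * (q + k)))) <= 10 ^ m.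
Proof.
  intros Hq Hq1 Hm Hln Hk.
  assert (HM : 2 <= INR m) by (apply (le_INR 2); auto).
  assert (Hn : 0 <= INR n) by apply pos_INR.
  assert (Hqk : 0 < 2 * (q + k)) by lra.
  destruct (Rle_dec k q) as [Hkq|Hkq].
  - rewrite sqrt_pow_exp_ln, <- exp_plus by lra.
    apply Rle_trans with (exp 0); [|rewrite exp_0; apply pow_R1_Rle; lra].
    apply exp_le_compat.
    assert (k ^ 2 / 4 <= k ^ 2 * q / (2 * (q + k))).
    { apply Rmult_le_reg_r with (4 * (2 * (q + k))); [lra|].
      replace (k ^ 2 / 4 * (4 * (2 * (q + k)))) with (k ^ 2 * (2 * (q + k))) by field.
      replace (k ^ 2 * q / (2 * (q + k)) * (4 * (2 * (q + k)))) with (k ^ 2 * (4 * q)) by (field; lra).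
      apply Rmult_le_compat_l; [apply pow2_ge_0|lra]. }
    assert (INR m * (ln (INR n + 1) / 2) <= INR m * ((INR m - 1) / 4))
      by (apply Rmult_le_compat_l; lra).
    assert (INR m * ((INR m - 1) / 4) <= k ^ 2 / 4) by (rewrite Hk; nra).
    lra.
  (* Here [q + k < 2 * k], and [4 / 5 * m <= k] because [3 / 8 <= m / 5] for [m >= 2]. *)
  - assert (H1 : INR m * (q / 5) <= k ^ 2 * q / (2 * (q + k))).
    { apply Rmult_le_reg_r with (2 * (q + k)); auto.
      replace (k ^ 2 * q / (2 * (q + k)) * (2 * (q + k))) with (q * k ^ 2) by (field; lra).
      replace (INR m * (q / 5) * (2 * (q + k))) with (q * (INR m / 5 * (2 * (q + k)))) by field.
      apply Rmult_le_compat_l; [lra|].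
      apply Rle_trans with (INR m / 5 * (4 * k)); [apply Rmult_le_compat_l; lra|].
      assert (INR m * 4 / 5 <= k) by lra. nra. }
    assert (H2 : sqrt (INR n + 1) <= 10 * exp (q / 5)).
    { assert (sqrt (INR n + 1) <= q + 1).
      { rewrite <- (sqrt_pow2 (q + 1)) by lra. apply sqrt_le_1_alt.
        assert (q * q = INR n) by (rewrite Hq; apply sqrt_sqrt; auto). nra. }
      pose proof (exp_ineq1_le (q / 5)). lra. }
    apply Rle_trans with ((10 * exp (q / 5)) ^ m * exp (- (INR m * (q / 5)))).
    + apply Rmult_le_compat.
      * apply pow_le, sqrt_pos.
      * left; apply exp_pos.
      * apply pow_incr. split; [apply sqrt_pos|auto].
      * apply exp_le_compat; lra.
    + rewrite Rpow_mult_distr, <- exp_mult_INR, Rmult_assoc, <- exp_plus, Rplus_opp_r, exp_0. lra.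
Qed.

Lemma omega_taylor_large_argument (n m : nat) (x : R) : 0 < x ->
  1 + 2 * ln (INR n + 1) <= INR m ->
  (if Nat.leb n 1 then 0 else INR n + INR m * (sqrt (INR n) + 2)) < x ->
  Rabs (omega_taylor n m x) <= 320 ^ m.
Proof.
  intros Hx Hln Hlx.
  assert (Hn : 0 <= INR n) by apply pos_INR.
  assert (Hl0 : 0 <= ln (INR n + 1)) by (rewrite <- ln_1; apply ln_le; lra).
  assert (Hm : (1 <= m)%nat) by (apply INR_le; simpl INR; lra).
  assert (Hb : forall a, 1 <= a -> a <= a ^ m).
  { intros a Ha. rewrite <- (pow_1 a) at 1. apply Rle_pow; auto. }
  (* For [n <= 1] the factor [sqrt (n + 1)] is bounded, so the general estimate suffices; since
     [m >= 1], constants fit into the [m]-th power. *)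
  destruct (Nat.leb_spec n 1) as [Hn1|Hn1].
  - apply Rle_trans with (1 := omega_taylor_general n m x Hx ltac:(lia)).
    pose proof (sqrt_succ_ge_1 n).
    assert (INR n <= 1) by (apply (le_INR n 1); auto).
    assert (sqrt (INR n + 1) <= 2).
    { rewrite <- (sqrt_pow2 2) by lra. apply sqrt_le_1_alt. lra. }
    apply Rle_trans with ((12 * 2) ^ m * 12 ^ m).
    + apply Rmult_le_compat.
      * apply pow_le; lra.
      * apply Rlt_le, Rdiv_lt_0_compat; lra.
      * apply pow_incr; lra.
      * apply Rle_trans with (2 := Hb 12 ltac:(lra)).
        assert (/ sqrt (INR n + 1) <= / 1) by (apply Rinv_le_contravar; lra).
        rewrite Rinv_1 in *. unfold Rdiv. lra.
    + rewrite <- Rpow_mult_distr. apply pow_incr; lra.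
  - assert (HN : 2 <= INR n) by (apply (le_INR 2); lia).
    assert (Hl1 : 0 < ln (INR n + 1)) by (rewrite <- ln_1; apply ln_increasing; lra).
    assert (Hm2 : (2 <= m)%nat) by (apply (INR_lt 1); simpl INR; lra).
    assert (HM : 2 <= INR m) by (apply (le_INR 2); auto).
    set (q := sqrt (INR n)) in *.
    assert (E : q * q = INR n) by (apply sqrt_sqrt; auto).
    assert (Hq : 1 <= q) by (unfold q; rewrite <- sqrt_1 at 1; apply sqrt_le_1_alt; lra).
    (* Shrinking [x] by [1 - tilt n] loses at most [3 / 8 * q] from [n], [3 / 8 * m] from [m * q]
       and [3 / 4 * m] from [2 * m]. The surplus [2 * m] absorbs the last two; the first turns
       [m * q] into [(m - 3 / 8) * q]. *)
    set (k := INR m - 3 / 8).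
    set (y := INR n + k * q).
    pose proof (tilt_bounds n) as Ht.
    assert (Htq : tilt n * q <= 3 / 8).
    { unfold tilt. assert (q <= sqrt (INR n + 1)) by (apply sqrt_le_1_alt; lra).
      apply Rmult_le_reg_r with (8 * sqrt (INR n + 1)); [lra|].
      replace (3 / (8 * sqrt (INR n + 1)) * q * (8 * sqrt (INR n + 1))) with (3 * q) by (field; lra).
      lra. }
    assert (Hy : y <= (1 - tilt n) * x).
    { apply Rle_trans with ((1 - tilt n) * (INR n + INR m * (q + 2))).
      2: apply Rmult_le_compat_l; lra.
      assert (tilt n * INR n <= 3 / 8 * q) by (rewrite <- E; nra).
      assert (tilt n * q * INR m <= 3 / 8 * INR m) by (apply Rmult_le_compat_r; lra).
      assert (tilt n * INR m <= 3 / 8 * INR m) by (apply Rmult_le_compat_r; lra).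
      unfold y, k. lra. }
    assert (Hy1 : INR n + 1 <= y) by (unfold y, k; nra).
    assert (Hpy : poisson n y <= exp (- (k ^ 2 * q / (2 * (q + k))))).
    { assert (Hk : 0 < k) by (unfold k; lra).
      assert (Hz : 0 <= k / q) by (apply Rlt_le, Rdiv_lt_0_compat; lra).
      assert (H := poisson_upper_tail n (k / q) Hz).
      replace (INR n * (1 + k / q)) with y in H by (unfold y; rewrite <- E; field; lra).
      replace (INR n * ((k / q) ^ 2 / (2 * (1 + k / q)))) with (k ^ 2 * q / (2 * (q + k))) in H; auto.
      rewrite <- E. field. lra. }
    assert (Hom : forall y', y <= y' -> omega n y' <= 2 * poisson n y).
    { intros y' Hy'. apply Rle_trans with (1 := omega_tail n y y' ltac:(lra)).
      apply Rmult_le_compat_l; [lra|].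
      rewrite <- (Rmult_1_r (poisson n y)) at 2.
      apply Rmult_le_compat_l; [apply poisson_pos; lra|].
      apply Rle_trans with (exp 0); [|rewrite exp_0; lra]. apply exp_le_compat.
      assert (0 <= 1 - INR n / y).
      { apply Rmult_le_reg_r with y; [lra|]. unfold Rdiv.
        rewrite Rmult_minus_distr_r, Rmult_assoc, Rinv_l by lra. lra. }
      assert (0 <= (1 - INR n / y) * (y' - y)) by (apply Rmult_le_pos; lra). lra. }
    apply Rle_trans with (1 := omega_taylor_bound n m x Hx).
    assert (O1 := Hom ((1 - tilt n) * x) Hy).
    assert (O2 := Hom ((1 + tilt n) * x) ltac:(nra)).
    pose proof (sqrt_succ_ge_1 n) as Hs.
    assert (HG := sqrt_pow_gaussian_le n m q k eq_refl Hq Hm2 Hln eq_refl).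
    rewrite Rpow_mult_distr.
    assert (P1 : 0 < 4 ^ m) by (apply pow_lt; lra).
    assert (P2 : 0 < sqrt (INR n + 1) ^ m) by (apply pow_lt; lra).
    apply Rle_trans with (2 * (4 ^ m * sqrt (INR n + 1) ^ m) *
      (4 * exp (- (k ^ 2 * q / (2 * (q + k)))))).
    { apply Rmult_le_compat_l; [|lra]. apply Rmult_le_pos; [lra|nra]. }
    replace (2 * (4 ^ m * sqrt (INR n + 1) ^ m) * (4 * exp (- (k ^ 2 * q / (2 * (q + k)))))) with
      (8 * 4 ^ m * (sqrt (INR n + 1) ^ m * exp (- (k ^ 2 * q / (2 * (q + k)))))) by ring.
    apply Rle_trans with (8 ^ m * 4 ^ m * 10 ^ m).
    + apply Rmult_le_compat.
      * lra.
      * apply Rmult_le_pos; [lra|left; apply exp_pos].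
      * apply Rmult_le_compat_r; [lra|]. apply Hb; lra.
      * auto.
    + rewrite <- !Rpow_mult_distr. apply pow_incr; lra.
Qed.

(** * Small arguments: Bessel's equation lowers the index by two *)

(* Integration by parts with primitive [sqrt (t ^ 2 - 1) * t ^ (p + 1) * exp (- x * t)]:
   Bessel's equation for [K0], differentiated [p + 1] times. *)
Lemma bessel_moment_recurrence (p : nat) (x : R) : 0 < x ->
  x * (bessel_moment (p + 3) x - bessel_moment (p + 1) x) =
  INR (p + 2) * bessel_moment (p + 2) x - INR (p + 1) * bessel_moment p x.
Proof.
  intros Hx.
  assert (Hcomb := newton_int_lincomb 1 1 _ _ _ _
    (newton_int_lincomb (INR (p + 2)) (- INR (p + 1)) _ _ _ _
      (bessel_moment_newton (p + 2) x Hx) (bessel_moment_newton p x Hx))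
    (newton_int_lincomb (- x) x _ _ _ _
      (bessel_moment_newton (p + 3) x Hx) (bessel_moment_newton (p + 1) x Hx))).
  match type of Hcomb with newton_int ?f ?l =>
    assert (H0 : newton_int f 0); [|pose proof (newton_int_unique f l 0 Hcomb H0); lra] end.
  set (M := INR (fact (p + 1)) / x ^ (p + 1)).
  set (M' := INR (fact (p + 3)) / x ^ (p + 3)).
  assert (HM : 0 < M) by (apply Rdiv_lt_0_compat; [apply INR_fact_lt_0|apply pow_lt; auto]).
  assert (HM' : 0 < M') by (apply Rdiv_lt_0_compat; [apply INR_fact_lt_0|apply pow_lt; auto]).
  exists (fun t => sqrt (t ^ 2 - 1) * (t ^ (p + 1) * exp (- x * t))). split; [|split].
  - intros t Ht. pose proof (sqrt_weight_pos t Ht) as Hq.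
    pose proof (sqrt_weight_sqr t Ht) as Hqq.
    unfold bessel_integrand. auto_derive; [nra|].
    replace (t * (t * 1) + - (1)) with (t ^ 2 - 1) by ring.
    replace (Init.Nat.pred (p + 1)) with p by lia.
    set (q := sqrt (t ^ 2 - 1)) in *.
    rewrite (plus_INR p 2), (plus_INR p 1), !pow_add. simpl INR.
    set (e := exp (- x * t)). set (u := t ^ p).
    apply Rmult_eq_reg_r with q; [|lra].
    match goal with |- ?L * q = ?R * q =>
      replace (L * q) with (t * (u * t ^ 1 * e) + q * q * ((INR p + 1) * u * e - x * (u * t ^ 1 * e)))
        by (simpl; field; lra);
      replace (R * q) with ((INR p + (1 + 1)) * (u * t ^ 2 * e) - (INR p + 1) * (u * e)
        - x * (u * t ^ 3 * e) + x * (u * t ^ 1 * e)) by (field; lra) end.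
    rewrite Hqq. ring.
  - intros e He.
    (* For [1 < t < 1 + d <= 2] one has [t ^ 2 - 1 = (t - 1) * (t + 1) < 3 * d], so
       [sqrt (t ^ 2 - 1) < e / M]. *)
    set (d := Rmin 1 ((e / M) ^ 2 / 3)).
    assert (He' : 0 < e / M) by (apply Rdiv_lt_0_compat; auto).
    exists d. split.
    { apply Rmin_glb_lt; [lra|]. assert (0 < (e / M) ^ 2) by (apply pow_lt; auto). lra. }
    intros t Ht. assert (Hd1 : d <= 1) by apply Rmin_l.
    assert (Hd2 : d <= (e / M) ^ 2 / 3) by apply Rmin_r.
    pose proof (sqrt_weight_pos t ltac:(lra)).
    assert (Hb := pow_exp_le (p + 1) x t Hx ltac:(lra)). fold M in Hb.
    assert (0 <= t ^ (p + 1) * exp (- x * t))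
      by (apply Rmult_le_pos; [apply pow_le; lra|left; apply exp_pos]).
    rewrite Rabs_pos_eq by (apply Rmult_le_pos; lra).
    assert (Hs : sqrt (t ^ 2 - 1) < e / M).
    { rewrite <- (sqrt_pow2 (e / M)) by lra. apply sqrt_lt_1_alt. nra. }
    apply Rle_lt_trans with (sqrt (t ^ 2 - 1) * M); [apply Rmult_le_compat_l; lra|].
    replace e with (e / M * M) by (field; lra). apply Rmult_lt_compat_r; auto.
  - intros e He. exists (Rmax 1 (M' / e)). intros t Ht.
    assert (Ht1 : 1 < t) by (apply Rle_lt_trans with (2 := Ht); apply Rmax_l).
    assert (Ht2 : M' / e < t) by (apply Rle_lt_trans with (2 := Ht); apply Rmax_r).
    rewrite Rminus_0_r.
    pose proof (sqrt_weight_pos t Ht1). pose proof (sqrt_weight_le t Ht1).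
    assert (0 <= t ^ (p + 1) * exp (- x * t))
      by (apply Rmult_le_pos; [apply pow_le; lra|left; apply exp_pos]).
    rewrite Rabs_pos_eq by (apply Rmult_le_pos; lra).
    assert (Hb := pow_exp_le (p + 3) x t Hx ltac:(lra)). fold M' in Hb.
    apply Rle_lt_trans with (t * (t ^ (p + 1) * exp (- x * t))); [apply Rmult_le_compat_r; auto|].
    apply Rmult_lt_reg_r with t; [lra|].
    replace (t * (t ^ (p + 1) * exp (- x * t)) * t) with (t ^ (p + 3) * exp (- x * t))
      by (rewrite !pow_add; simpl; ring).
    apply Rle_lt_trans with (1 := Hb).
    replace M' with (e * (M' / e)) by (field; lra). apply Rmult_lt_compat_l; auto.
Qed.

Lemma omega_taylor_1 (n : nat) (x : R) : 0 < x ->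
  omega_taylor n 1 x = (INR n * scaled_moment n x - scaled_moment (S n) x) / INR (fact n).
Proof.
  intros Hx. assert (H1 := omega_taylor_derive n 0 x Hx).
  assert (H2 : is_derive (omega_taylor n 0) x
    (/ INR (fact n) * ((INR n * scaled_moment n x - scaled_moment (S n) x) / x))).
  { apply is_derive_ext with (fun y => / INR (fact n) * scaled_moment n y).
    - intros t. unfold omega_taylor. rewrite taylor_comb_0. apply Rmult_comm.
    - apply (is_derive_scal (scaled_moment n) x), scaled_moment_derive; auto. }
  apply is_derive_unique in H1. apply is_derive_unique in H2. rewrite H1 in H2.
  simpl INR in H2. rewrite Rmult_0_l, Rplus_0_l, Rmult_1_l in H2.
  replace (omega_taylor n 1 x) with (x * (omega_taylor n 1 x / x)) by (field; lra).
  rewrite H2. field. split; [apply INR_fact_neq_0|lra].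
Qed.

(** Leibniz' rule for [x ^ 2 * f' + x * f] with [f = omega p], whose [m]-th derivative is [x ^ 2 *
    D^(m+1) f + (2 * m + 1) * x * D^m f + m ^ 2 * D^(m-1) f]. The proof differentiates one order at
    a time, starting from the recurrence of the moments. *)
Lemma omega_taylor_recurrence (p m : nat) (x : R) : 0 < x ->
  INR (S m) * omega_taylor (S (S p)) (S m) x =
  x ^ 2 / (INR (S (S p)) * INR (S p)) *
  (INR (S m) * omega_taylor p (S m) x + (2 * INR m + 1) * omega_taylor p m x
   + INR m * omega_taylor p (pred m) x).
Proof.
  assert (Hp1 : INR (S p) <> 0) by (apply not_0_INR; lia).
  assert (Hp2 : INR (S (S p)) <> 0) by (apply not_0_INR; lia).
  revert x; induction m as [|m IH]; intros x Hx.
  - rewrite !omega_taylor_1 by auto. unfold omega_taylor. rewrite taylor_comb_0.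
    unfold scaled_moment.
    assert (E := bessel_moment_recurrence p x Hx).
    replace (p + 3)%nat with (S (S (S p))) in E by lia.
    replace (p + 2)%nat with (S (S p)) in E by lia.
    replace (p + 1)%nat with (S p) in E by lia.
    rewrite !(fact_simpl (S p)), !(fact_simpl p), !mult_INR.
    replace (INR 1) with 1 by reflexivity. replace (INR 0) with 0 by reflexivity.
    simpl pow. rewrite (S_INR p) in *. rewrite (S_INR (S p)) in *. rewrite (S_INR p) in *.
    pose proof (INR_fact_neq_0 p).
    set (I3 := bessel_moment (S (S (S p))) x) in *. set (I2 := bessel_moment (S (S p)) x) in *.
    set (I1 := bessel_moment (S p) x) in *. set (I0 := bessel_moment p x) in *.
    assert (E' : x * I3 = x * I1 + (INR p + 1 + 1) * I2 - (INR p + 1) * I0) by lra.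
    replace I3 with ((x * I1 + (INR p + 1 + 1) * I2 - (INR p + 1) * I0) / x)
      by (rewrite <- E'; field; lra).
    field. repeat split; auto; lra.
  - set (c := / (INR (S (S p)) * INR (S p))).
    assert (H1 := is_derive_scal (omega_taylor (S (S p)) (S m)) x (INR (S m)) _
      (omega_taylor_derive (S (S p)) (S m) x Hx)).
    assert (H2 : is_derive (fun y => c * (y ^ 2 *
        (INR (S m) * omega_taylor p (S m) y + (2 * INR m + 1) * omega_taylor p m y
         + INR m * omega_taylor p (pred m) y))) x
      (c * (2 * x * (INR (S m) * omega_taylor p (S m) x + (2 * INR m + 1) * omega_taylor p m x
           + INR m * omega_taylor p (pred m) x)
        + x ^ 2 * (INR (S m) * ((INR (S m) * omega_taylor p (S m) x
                  + INR (S (S m)) * omega_taylor p (S (S m)) x) / x)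
         + (2 * INR m + 1) * ((INR m * omega_taylor p m x + INR (S m) * omega_taylor p (S m) x) / x)
         + INR m * ((INR (pred m) * omega_taylor p (pred m) x
                  + INR (S (pred m)) * omega_taylor p (S (pred m)) x) / x))))).
    { apply (is_derive_scal (fun y => y ^ 2 *
        (INR (S m) * omega_taylor p (S m) y + (2 * INR m + 1) * omega_taylor p m y
         + INR m * omega_taylor p (pred m) y)) x).
      apply (is_derive_mult (fun y => y ^ 2) (fun y =>
        INR (S m) * omega_taylor p (S m) y + (2 * INR m + 1) * omega_taylor p m y
         + INR m * omega_taylor p (pred m) y) x); [| |intros; apply Rmult_comm].
      - auto_derive; auto; ring.
      - apply (is_derive_plus (fun y =>
          INR (S m) * omega_taylor p (S m) y + (2 * INR m + 1) * omega_taylor p m y)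
          (fun y => INR m * omega_taylor p (pred m) y) x).
        + apply (is_derive_plus (fun y => INR (S m) * omega_taylor p (S m) y)
            (fun y => (2 * INR m + 1) * omega_taylor p m y) x).
          * apply (is_derive_scal (omega_taylor p (S m)) x), omega_taylor_derive; auto.
          * apply (is_derive_scal (omega_taylor p m) x), omega_taylor_derive; auto.
        + apply (is_derive_scal (omega_taylor p (pred m)) x), omega_taylor_derive; auto. }
    assert (H3 := H1).
    apply is_derive_ext_loc with (g := fun y => c * (y ^ 2 *
        (INR (S m) * omega_taylor p (S m) y + (2 * INR m + 1) * omega_taylor p m y
         + INR m * omega_taylor p (pred m) y))) in H3.
    2: { apply locally_pos; auto. intros y Hy. rewrite IH by auto.
         match goal with |- @eq _ ?a ?b => change (@eq R a b) end. unfold c, Rdiv. ring. }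
    apply is_derive_unique in H3. apply is_derive_unique in H2. assert (H4 := eq_trans (eq_sym H2) H3).
    clear H1 H2 H3. rename H4 into H3.
    match type of H3 with @eq _ ?a ?b => change (@eq R a b) in H3 end.
    specialize (IH x Hx). unfold Rdiv in IH at 1. fold c in IH. unfold Rdiv at 1. fold c.
    set (T1 := omega_taylor (S (S p)) (S m) x) in *.
    set (T2 := omega_taylor (S (S p)) (S (S m)) x) in *.
    set (U2 := omega_taylor p (S (S m)) x) in *. set (U1 := omega_taylor p (S m) x) in *.
    set (U0 := omega_taylor p m x) in *. simpl (pred (S m)). fold U0.
    (* At [m = 0] the truncated [pred m] differs from [m - 1], but the factor [m] removes the
       term. *)
    assert (HU : INR m * (INR (pred m) * omega_taylor p (pred m) x
        + INR (S (pred m)) * omega_taylor p (S (pred m)) x) =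
      INR m * ((INR m - 1) * omega_taylor p (pred m) x + INR m * U0)).
    { destruct m as [|k]; [simpl; ring|]. simpl pred. rewrite S_INR. fold U0. ring. }
    set (V := omega_taylor p (pred m) x) in *.
    set (W := INR (S (pred m)) * omega_taylor p (S (pred m)) x) in *.
    rewrite !S_INR in *.
    assert (E1 : (INR m + 1) * ((INR m + 1) * T1 + (INR m + 1 + 1) * T2) =
      c * (2 * x ^ 2 * ((INR m + 1) * U1 + (2 * INR m + 1) * U0 + INR m * V) +
        x ^ 2 * ((INR m + 1) * ((INR m + 1) * U1 + (INR m + 1 + 1) * U2) +
         (2 * INR m + 1) * (INR m * U0 + (INR m + 1) * U1) +
         INR m * ((INR m - 1) * V + INR m * U0)))).
    { rewrite <- HU.
      transitivity (x * ((INR m + 1) * (((INR m + 1) * T1 + (INR m + 1 + 1) * T2) / x))); [field; lra|].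
      rewrite <- H3. field. lra. }
    pose proof (pos_INR m).
    apply Rmult_eq_reg_l with (INR m + 1); [|lra].
    assert (E2 : (INR m + 1) * ((INR m + 1 + 1) * T2) =
      (INR m + 1) * ((INR m + 1) * T1 + (INR m + 1 + 1) * T2)
      - (INR m + 1) * ((INR m + 1) * T1)) by ring.
    rewrite E2, E1, IH. ring.
Qed.

(** The three coefficients of [omega_taylor_recurrence] add up to [4 * m + 2 <= 4 * (m + 1)], and
    the quotient in front is at most [/ 16]. *)
Lemma omega_taylor_step (p m : nat) (x K : R) : 0 < x ->
  16 * x ^ 2 <= (INR p + 1) * (INR p + 2) ->
  (forall j, (j <= S m)%nat -> Rabs (omega_taylor p j x) <= K) ->
  Rabs (omega_taylor (S (S p)) (S m) x) <= K / 4.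
Proof.
  intros Hx Hxp HK.
  assert (E := omega_taylor_recurrence p m x Hx).
  pose proof (pos_INR p) as Hp. pose proof (pos_INR m) as Hm.
  set (c := x ^ 2 / (INR (S (S p)) * INR (S p))) in *.
  assert (Hc : 0 <= c <= / 16).
  { unfold c. rewrite !S_INR. assert (0 <= x ^ 2) by apply pow2_ge_0.
    assert (0 < (INR p + 1 + 1) * (INR p + 1)) by nra. split.
    - apply Rmult_le_pos; auto. left; apply Rinv_0_lt_compat; auto.
    - apply Rmult_le_reg_r with ((INR p + 1 + 1) * (INR p + 1)); auto.
      unfold Rdiv. rewrite Rmult_assoc, Rinv_l by lra. lra. }
  assert (K1 := HK (S m) ltac:(lia)). assert (K2 := HK m ltac:(lia)).
  assert (K3 := HK (pred m) ltac:(lia)).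
  assert (HK0 : 0 <= K) by (apply Rle_trans with (2 := K1), Rabs_pos).
  apply Rmult_le_reg_l with (INR (S m)); [apply lt_0_INR; lia|].
  rewrite <- (Rabs_pos_eq (INR (S m))) at 1 by apply pos_INR.
  rewrite <- Rabs_mult, E, Rabs_mult, (Rabs_pos_eq c) by lra.
  assert (Hsum : Rabs (INR (S m) * omega_taylor p (S m) x + (2 * INR m + 1) * omega_taylor p m x
    + INR m * omega_taylor p (pred m) x) <= 4 * INR (S m) * K).
  { eapply Rle_trans; [apply Rabs_triang|].
    eapply Rle_trans; [apply Rplus_le_compat_r, Rabs_triang|].
    rewrite !Rabs_mult, (Rabs_pos_eq (INR (S m))), (Rabs_pos_eq (2 * INR m + 1)),
      (Rabs_pos_eq (INR m)) by (try apply pos_INR; lra).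
    rewrite S_INR. nra. }
  apply Rle_trans with (/ 16 * (4 * INR (S m) * K)); [|right; field].
  apply Rmult_le_compat; auto; try lra. apply Rabs_pos.
Qed.

(** The recurrence yields only orders at least 1, so order 0 enters at every level with its own
    bound [B]. The induction closes because [(B + A / 4 ^ J) / 4 <= B + A / 4 ^ (J + 1)]. *)
Lemma omega_taylor_iterate (p J M : nat) (x A B : R) : 0 < x ->
  16 * x ^ 2 <= (INR p + 1) * (INR p + 2) -> 0 <= A -> 0 <= B ->
  (forall i, Rabs (omega_taylor (2 * i + p) 0 x) <= B) ->
  (forall j, (j <= M)%nat -> Rabs (omega_taylor p j x) <= A) ->
  forall j, (1 <= j <= M)%nat -> Rabs (omega_taylor (2 * J + p) j x) <= B + A / 4 ^ J.
Proof.
  intros Hx Hxp HA HB H0 Hbase. induction J as [|J IH]; intros j Hj.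
  - simpl. specialize (Hbase j ltac:(lia)). lra.
  - replace (2 * S J + p)%nat with (S (S (2 * J + p))) by lia.
    destruct j as [|j]; [lia|].
    assert (H4 : 0 < 4 ^ J) by (apply pow_lt; lra).
    assert (HAJ : 0 <= A / 4 ^ J) by (apply Rmult_le_pos; auto; left; apply Rinv_0_lt_compat; auto).
    apply Rle_trans with ((B + A / 4 ^ J) / 4).
    + apply omega_taylor_step; auto.
      * apply Rle_trans with (1 := Hxp). rewrite plus_INR.
        pose proof (pos_INR p). pose proof (pos_INR (2 * J)). nra.
      * intros i Hi. destruct i as [|i].
        -- specialize (H0 J). lra.
        -- apply IH. lia.
    + replace (A / 4 ^ S J) with (A / 4 ^ J / 4) by (simpl; field; lra). lra.
Qed.

Lemma omega_taylor_small_argument (n m : nat) (x : R) : 0 < x -> (0 < n)%nat ->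
  2 * floor_R (INR m * ln (INR n + 1) / (4 * ln 2)) - 2 <= (INR n - 1) / 2 ->
  4 * x <= (INR n + 1) / 2 ->
  Rabs (omega_taylor n m x) <= 400 ^ m * (400 / sqrt (INR n + 1)).
Proof.
  intros Hx Hn Hfl Hxn.
  pose proof (sqrt_succ_ge_1 n) as Hq.
  assert (HN : 1 <= INR n) by (apply (le_INR 1); lia).
  destruct m as [|m'].
  { apply Rle_trans with (1 := omega_taylor_general n 0 x Hx ltac:(lia)). simpl.
    rewrite !Rmult_1_l. unfold Rdiv. apply Rmult_le_compat_r; [|lra].
    left; apply Rinv_0_lt_compat; lra. }
  set (m := S m') in *.
  assert (Hl2 : 0 < ln 2) by (rewrite <- ln_1; apply ln_increasing; lra).
  assert (Hln : 0 <= ln (INR n + 1)) by (rewrite <- ln_1; apply ln_le; lra).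
  set (v := INR m * ln (INR n + 1) / (4 * ln 2)) in *.
  assert (Hv : 0 <= v).
  { apply Rmult_le_pos; [apply Rmult_le_pos; [apply pos_INR|auto]|].
    left; apply Rinv_0_lt_compat; lra. }
  destruct (base_Int_part v) as [_ Hv2]. unfold floor_R in Hfl.
  assert (Hz : (0 <= Int_part v)%Z).
  { assert (IZR (-1) < IZR (Int_part v)) by lra. apply lt_IZR in H. lia. }
  (* [J] is the floor of [v] minus 1, cut off at 0. The floor condition then reads
     [2 * J <= (n - 1) / 2], while [v < J + 2] costs a factor [4 ^ 2 = 16] below. *)
  assert (HJ : exists J : nat, 2 * INR J <= (INR n - 1) / 2 /\ v < INR J + 2).
  { rewrite <- (Z2Nat.id (Int_part v) Hz), <- INR_IZR_INZ in Hv2, Hfl.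
    destruct (Z.to_nat (Int_part v)) as [|J].
    - exists 0%nat. simpl in *. lra.
    - exists J. rewrite S_INR in *. lra. }
  destruct HJ as [J [HJ1 HJ2]].
  assert (HJn : (2 * J <= n)%nat).
  { apply INR_le. rewrite mult_INR. simpl (INR 2). lra. }
  set (p := (n - 2 * J)%nat).
  assert (Hp : INR p = INR n - 2 * INR J).
  { unfold p. rewrite minus_INR, mult_INR by auto. simpl (INR 2). ring. }
  (* At least half of the index survives: [p >= (n + 1) / 2 >= 4 * x] supplies the condition of the
     iteration, and [sqrt (p + 1) >= q / 2] costs only a factor 2. *)
  assert (Hpn : (INR n + 1) / 2 <= INR p) by lra.
  replace n with (2 * J + p)%nat at 1 by (unfold p; lia).
  set (q := sqrt (INR n + 1)) in *.
  assert (Hp0 : (0 < p)%nat) by (apply INR_lt; simpl; lra).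
  assert (Hcmp : forall k, (p <= k)%nat -> / sqrt (INR k + 1) <= 2 / q).
  { intros k Hk. apply le_INR in Hk. pose proof (sqrt_succ_ge_1 k).
    assert (q <= 2 * sqrt (INR k + 1)).
    { unfold q. rewrite <- (sqrt_pow2 2) at 1 by lra. rewrite <- sqrt_mult by lra.
      apply sqrt_le_1_alt. lra. }
    replace (2 / q) with (/ (q / 2)) by (field; lra). apply Rinv_le_contravar; lra. }
  set (A := (12 * q) ^ m * (24 / q)).
  assert (H12 : 0 < (12 * q) ^ m) by (apply pow_lt; lra).
  assert (Hiq : 0 < / q) by (apply Rinv_0_lt_compat; lra).
  assert (HA : 0 <= A) by (apply Rmult_le_pos; [lra|unfold Rdiv; lra]).
  apply Rle_trans with (6 / q + A / 4 ^ J).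
  { apply (omega_taylor_iterate p J m); auto.
    - assert (4 * x <= INR p) by lra.
      assert (16 * x ^ 2 = (4 * x) * (4 * x)) by ring. nra.
    - unfold Rdiv; lra.
    - intros i. rewrite omega_taylor_0, Rabs_pos_eq by (auto; apply omega_nonneg; auto).
      apply Rle_trans with (1 := omega_le_3 (2 * i + p) x ltac:(lia) Hx).
      pose proof (Hcmp (2 * i + p)%nat ltac:(lia)). unfold Rdiv in *. lra.
    - intros j Hj. apply Rle_trans with (1 := omega_taylor_general p j x Hx ltac:(lia)).
      pose proof (sqrt_succ_ge_1 p). pose proof (Hcmp p ltac:(lia)).
      unfold A. apply Rmult_le_compat.
      + apply pow_le; lra.
      + apply Rlt_le, Rdiv_lt_0_compat; lra.
      + apply Rle_trans with ((12 * q) ^ j).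
        * apply pow_incr. split; [lra|]. apply Rmult_le_compat_l; [lra|].
          apply sqrt_le_1_alt. pose proof (pos_INR J). lra.
        * apply Rle_pow; [lra|auto].
      + unfold Rdiv in *. lra.
    - unfold m; lia. }
  (* Since [v * (2 * ln 2) = m * ln (n + 1) / 2], one has [q ^ m = 4 ^ v <= 4 ^ (J + 2)]: the [J]
     gains repay the loss of the general estimate up to 16. *)
  assert (Hgain : q ^ m <= 16 * 4 ^ J).
  { unfold q. rewrite sqrt_pow_exp_ln by lra.
    assert (E4 : 16 * 4 ^ J = exp (INR (J + 2) * (2 * ln 2))).
    { rewrite exp_mult_INR. replace (2 * ln 2) with (ln 2 + ln 2) by ring.
      rewrite exp_plus, exp_ln, pow_add by lra. replace (2 * 2) with 4 by ring. ring. }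
    rewrite E4. apply exp_le_compat. rewrite plus_INR. simpl (INR 2).
    replace (INR m * (ln (INR n + 1) / 2)) with (v * (2 * ln 2)) by (unfold v; field; lra).
    apply Rmult_le_compat_r; lra. }
  assert (H4 : 0 < 4 ^ J) by (apply pow_lt; lra).
  assert (Hg2 : A / 4 ^ J <= 12 ^ m * (384 / q)).
  { unfold A. rewrite Rpow_mult_distr. apply Rmult_le_reg_r with (4 ^ J); auto.
    replace (12 ^ m * q ^ m * (24 / q) / 4 ^ J * 4 ^ J) with (12 ^ m * (24 / q) * q ^ m) by (field; lra).
    replace (12 ^ m * (384 / q) * 4 ^ J) with (12 ^ m * (24 / q) * (16 * 4 ^ J)) by (field; lra).
    apply Rmult_le_compat_l; auto. apply Rmult_le_pos; [apply pow_le; lra|unfold Rdiv; lra]. }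
  assert (H1m : 1 <= 12 ^ m) by (apply pow_R1_Rle; lra).
  (* [24 * 16 = 384], and the bound for order 0 adds 6. *)
  apply Rle_trans with (12 ^ m * (400 / q)).
  - assert (6 / q <= 12 ^ m * (6 / q)) by (unfold Rdiv; nra).
    unfold Rdiv in *. nra.
  - apply Rmult_le_compat_r; [unfold Rdiv; lra|]. apply pow_incr; lra.
Qed.

Theorem theorem1 :
  (exists gamma : R, 1 <= gamma /\
     forall (n m : nat) (x : R), 0 < x ->
       Rabs (Derive_n (omega n) m x) <=
         INR (fact m) * (gamma * sqrt (INR n + 1) / x) ^ m *
         (kronecker m 0 / sqrt (2 * x + 1) +
          gamma / sqrt (INR n + 1) *
            (1 + kronecker (m + n) 0 * ln ((x + 1) / x))))
  /\
  (forall C : R, 1 < C ->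
     exists gamma : R, 1 < gamma /\
       forall n m : nat,
         INR m <= sqrt (INR n) * ((C - 1) / C) ->
         2 * floor_R (INR m * ln (INR n + 1) / (4 * ln 2)) - 2
           <= (INR n - 1) / 2 ->
         forall x : R,
           0 < x <= Rmin (INR n / (2 * C)) ((INR n + 1) / (4 * gamma)) ->
           Rabs (Derive_n (omega n) m x) <=
             INR (fact m) * (gamma / x) ^ m *
             (kronecker m 0 / sqrt (2 * x + 1) +
              gamma / sqrt (INR n + 1) *
                (1 + kronecker (n + m) 0 * ln ((x + 1) / x))))
  /\
  (exists gamma : R, 1 <= gamma /\
     forall n m : nat,
       1 + 2 * ln (INR n + 1) <= INR m ->
       forall x : R,
         (if Nat.leb n 1 then 0 else INR n + INR m * (sqrt (INR n) + 2)) < x ->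
         Rabs (Derive_n (omega n) m x) <= INR (fact m) * (gamma / x) ^ m)
  /\
  (forall (n : nat) (x : R),
     Rmax 1 (INR n + sqrt (INR n)) <= x ->
     Rabs (omega n x) <=
       3 * (exp (sqrt (INR n) - x / (1 + sqrt (INR n))) / sqrt (INR n + 1))).
Proof.
  split; [|split; [|split]].
  - exists 12. split; [lra|]. exact omega_general_estimate.
  - intros C HC. exists 400. split; [lra|]. intros n m _ Hfl x [Hx Hxm].
    assert (Hx1 : x <= INR n / (2 * C)) by (apply Rle_trans with (1 := Hxm), Rmin_l).
    assert (Hx2 : x <= (INR n + 1) / (4 * 400)) by (apply Rle_trans with (1 := Hxm), Rmin_r).
    (* For [n = 0] the first entry of the minimum is 0, so no [x > 0] qualifies. *)
    assert (Hn : (0 < n)%nat).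
    { destruct n as [|n]; [|lia]. simpl in Hx1. unfold Rdiv in Hx1. lra. }
    apply Derive_n_omega_le; auto.
    pose proof (pos_INR n).
    apply Rle_trans with (1 := omega_taylor_small_argument n m x Hx Hn Hfl ltac:(lra)).
    apply Rmult_le_compat_l; [apply pow_le; lra|]. apply bracket_ge; lra.
  - exists 320. split; [lra|]. intros n m Hm x Hlx.
    assert (Hx : 0 < x).
    { apply Rle_lt_trans with (2 := Hlx). destruct (Nat.leb n 1); [lra|].
      pose proof (pos_INR n). pose proof (pos_INR m). pose proof (sqrt_pos (INR n)). nra. }
    rewrite <- (Rmult_1_r (INR (fact m) * (320 / x) ^ m)).
    apply Derive_n_omega_le; auto. rewrite Rmult_1_r.
    apply omega_taylor_large_argument; auto.
  - exact omega_exponential_decay.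
Qed.
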